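(* Assume $d_I<d_H$. SLINK-SEQ is exponentially consistent: there exists $\alpha>0$ (independent of $C$) such that, as $C\to\infty$, $$\mathbb{E}[N]\le\frac{-\log P_e(C)}{\alpha}\,(1+o(1)),$$ where $N=N(C)$ is the stopping time and $P_e(C)=\mathbb{P}\big[\{C_1(N),\dots,C_K(N)\}\neq\{P_1,\dots,P_K\}\big]$ is the error probability of SLINK-SEQ with parameter $C$.
   Context: Setting: $M\ge2$ mutually independent data sequences; sequence $i$ consists of i.i.d. samples $X^{(i)}_1,X^{(i)}_2,\dots$ from an unknown distribution $p_i$ on $\mathcal X$; $\{1,\dots,M\}$ is partitioned into $K\ge2$ nonempty true clusters $P_1,\dots,P_K$ ($K$ known). $k$ is a measurable positive-definite kernel with $0\le k\le\mathbb{G}$, $\mathcal F$ the unit ball of its RKHS, $d(p,q)=\sup_{f\in\mathcal F}(\mathbb{E}_pf-\mathbb{E}_qf)$ (MMD), $d(i,j)=d(p_i,p_j)$. Estimate: $\hat d(i,j,n)=\Big[\frac1{n^2}\sum_{l,m=1}^n\big(k(X^{(i)}_l,X^{(i)}_m)+k(X^{(j)}_l,X^{(j)}_m)-2k(X^{(i)}_l,X^{(j)}_m)\big)\Big]^{1/2}$. $d_H=\min_{k\neq l}\min_{i\in P_k,j\in P_l}d(i,j)$; $d_I(P_k)=\max\min_{i\in P_{1k},j\in P_{2k}}d(i,j)$ over partitions of $P_k$ into two nonempty disjoint sets (taken as $0$ if $|P_k|=1$); $d_I=\max_kd_I(P_k)$. SLINK with target number $K$ on dissimilarities $\delta$: start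 from singletons, repeatedly merge two current clusters $A\ne B$ minimizing $\min_{i\in A,j\in B}\delta(i,j)$ (ties arbitrary) until $K$ clusters remain. SLINK-SEQ with parameter $C>0$: at each time $n\ge2$ (one new sample of every sequence per time step), run SLINK with target $K$ on $\{\hat d(i,j,n)\}$ to get clusters $C_1(n),\dots,C_K(n)$, and compute $\Gamma_n=\min_{k\neq l}\min_{i\in C_k(n),j\in C_l(n)}\hat d(i,j,n)$; the stopping time is $N=\inf\{n\ge2:\Gamma_n\ge C/\sqrt n\}$ and the output is $\{C_1(N),\dots,C_K(N)\}$. *)

(* Defs.v *)
From HB Require Import structures.
From mathcomp Require Import all_boot all_order all_algebra.
From mathcomp Require Import all_classical all_reals all_analysis.

Set Implicit Arguments.
Unset Strict Implicit.
Unset Printing Implicit Defensive.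

Import Order.TTheory GRing.Theory Num.Theory.
Import numFieldNormedType.Exports.
Local Open Scope classical_set_scope.
Local Open Scope ring_scope.

Section Defs.
Context {R : realType}.

Definition pos_def_kernel {T : Type} (k : T -> T -> R) : Prop :=
  (forall x y, k x y = k y x) /\
  (forall (n : nat) (x : 'I_n -> T) (c : 'I_n -> R),
      0 <= \sum_(a < n) \sum_(b < n) c a * c b * k (x a) (x b)).

(** Unit ball of the RKHS of k (Aronszajn characterisation:
    f is in H_k with ||f||_{H_k} <= 1 iff k - f (x) f is positive semidefinite). *)
Definition rkhs_unit_ball {T : Type} (k : T -> T -> R) : set (T -> R) :=
  [set f | forall (n : nat) (x : 'I_n -> T) (c : 'I_n -> R),
      (\sum_(a < n) c a * f (x a)) ^+ 2
        <= \sum_(a < n) \sum_(b < n) c a * c b * k (x a) (x b)].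

Definition mmd {dT} {T : measurableType dT} (k : T -> T -> R)
    (p q : probability T R) : R :=
  sup [set fine (\int[p]_x (f x)%:E) - fine (\int[q]_x (f x)%:E)
      | f in rkhs_unit_ball k].

Definition mutually_independent {dO dT} {Omega : measurableType dO}
    {T : measurableType dT} {I : eqType} (P : probability Omega R)
    (X : I -> Omega -> T) : Prop :=
  forall (s : seq I) (B : I -> set T),
    uniq s -> (forall i, measurable (B i)) ->
    fine (P (\bigcap_(i in [set` s]) (X i @^-1` B i)))
      = \prod_(i <- s) fine (P (X i @^-1` B i)).

(** The MMD estimate \hat d(i,j,n) from samples 0..n-1 of each sequence
    (the paper's samples 1..n). *)
Definition dhat {Omega T : Type} {M : nat} (k : T -> T -> R)
    (X : 'I_M -> nat -> Omega -> T) (i j : 'I_M) (n : nat) (w : Omega) : R :=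
  Num.sqrt ((n%:R ^+ 2)^-1 *
    \sum_(l < n) \sum_(m < n)
       (k (X i l w) (X i m w) + k (X j l w) (X j m w)
        - 2 * k (X i l w) (X j m w))).

Definition linkage {M : nat} (delta : 'I_M -> 'I_M -> R) (A B : {set 'I_M}) : R :=
  inf [set delta i j | i in [set i | i \in A] & j in [set j | j \in B]].

Definition slink_step {M : nat} (delta : 'I_M -> 'I_M -> R)
    (Q Q' : {set {set 'I_M}}) : Prop :=
  exists A B, [/\ A \in Q, B \in Q, A != B,
    (forall A' B', A' \in Q -> B' \in Q -> A' != B' ->
        linkage delta A B <= linkage delta A' B') &
    Q' = (((Q :\ A) :\ B) :|: [set A :|: B])%SET].

Inductive slink_reach {M : nat} (delta : 'I_M -> 'I_M -> R) (K : nat)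
  : {set {set 'I_M}} -> Prop :=
| slink_init : slink_reach delta K ([set [set i] | i : 'I_M])%SET
| slink_next Q Q' : slink_reach delta K Q -> (K < #|Q|)%N ->
    slink_step delta Q Q' -> slink_reach delta K Q'.

(** Q is a possible output of SLINK with target K (for some tie-breaking). *)
Definition slink_output {M : nat} (delta : 'I_M -> 'I_M -> R) (K : nat)
    (Q : {set {set 'I_M}}) : Prop :=
  slink_reach delta K Q /\ #|Q| = K.

Definition inter_min {M : nat} (delta : 'I_M -> 'I_M -> R)
    (Q : {set {set 'I_M}}) : R :=
  inf [set r | exists i j A B,
        [/\ A \in Q, B \in Q, A != B, i \in A & j \in B] /\ r = delta i j].

Definition d_H {M : nat} (d : 'I_M -> 'I_M -> R) (Ptrue : {set {set 'I_M}}) : R :=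
  inter_min d Ptrue.

Definition d_I_block {M : nat} (d : 'I_M -> 'I_M -> R) (B : {set 'I_M}) : R :=
  if (#|B| <= 1)%N then 0 else
  sup [set linkage d B1 (B :\: B1) | B1 in
       [set B1 : {set 'I_M} | [/\ B1 \subset B, (0 < #|B1|)%N & (0 < #|B :\: B1|)%N]]].

Definition d_I {M : nat} (d : 'I_M -> 'I_M -> R) (Ptrue : {set {set 'I_M}}) : R :=
  \big[Num.max/0]_(B in Ptrue) d_I_block d B.

(** Stopping time N = inf {n >= 2 : Gamma_n >= C / sqrt n}, +oo if empty,
    where cl n w is the SLINK output at time n. *)
Definition stop_cond {Omega T : Type} {M : nat} (k : T -> T -> R)
    (X : 'I_M -> nat -> Omega -> T) (cl : nat -> Omega -> {set {set 'I_M}})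
    (C : R) (n : nat) (w : Omega) : Prop :=
  (2 <= n)%N /\ C / Num.sqrt n%:R <= inter_min (fun i j => dhat k X i j n w) (cl n w).

Definition stop_time {Omega T : Type} {M : nat} (k : T -> T -> R)
    (X : 'I_M -> nat -> Omega -> T) (cl : nat -> Omega -> {set {set 'I_M}})
    (C : R) (w : Omega) : \bar R :=
  match pselect (exists n, stop_cond k X cl C n w) with
  | left h => ((ex_minn (P := fun n => `[< stop_cond k X cl C n w >])
                 (let: ex_intro n hn := h in ex_intro _ n (asboolT hn)))%:R)%:E
  | right _ => +oo%E
  end.

Definition error_event {Omega T : Type} {M : nat} (k : T -> T -> R)
    (X : 'I_M -> nat -> Omega -> T) (cl : nat -> Omega -> {set {set 'I_M}})
    (C : R) (Ptrue : {set {set 'I_M}}) : set Omega :=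
  [set w | ~ exists n, stop_time k X cl C w = (n%:R)%:E /\ cl n w = Ptrue].

End Defs.

(* Main.v *)
Require Import Defs.
From HB Require Import structures.
From mathcomp Require Import all_boot all_order all_algebra.
From mathcomp Require Import all_classical all_reals all_analysis.
From mathcomp Require Import measurable_realfun ring lra zify.
Set Implicit Arguments.
Unset Strict Implicit.
Unset Printing Implicit Defensive.
Import Order.TTheory GRing.Theory Num.Theory.
Import numFieldNormedType.Exports.
Local Open Scope classical_set_scope.
Local Open Scope ring_scope.

(** Let [d] be the true and [dhat] the estimated dissimilarity, and [eta := (d_H - d_I) / 4].
    If [dhat] is [eta]-close to [d] at time [n], every SLINK merge before [K] clusters are left
    joins two parts of one true cluster, so SLINK is correct at time [n] and
    [Gamma_n >= d_H - eta >= d_H / 2].  The squared estimate is a bounded V-statistic, whence the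
    probability that [dhat] is not [eta]-close to [d] decays exponentially in [n].
    As [dhat ^+ 2 <= 2 G], no stop occurs before [n] is of order [C ^+ 2]; hence
    [P_e <= exp (- c C ^+ 2)].  Conversely a time [n >= 4 C ^+ 2 / d_H ^+ 2] with close estimates is
    a stop, so that [E N <= kappa C ^+ 2].  The ratio of the two constants is [alpha].

    That [mmd ^+ 2] is the mean of the V-statistic is shown by sampling: the inequalities defining
    the RKHS unit ball hold for the empirical measures, and pass to the limit in mean. *)

(** * Single linkage on approximate dissimilarities *)

(** Why a quarter of the gap: within a true cluster some link is estimated below [d_I + 2 * eta],
    one [eta] for the estimate and one for strictness, and a link across clusters above [d_H - eta].
    Correctness thus asks for [3 * eta < d_H - d_I]; and [eta <= d_H / 4] because [d_I >= 0].

    Terms of the V-statistic share samples. The two sequences are therefore paired into Z_l =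
    (X^i_l, X^j_l), and the index pairs are cut into families in which no sample recurs; this
    requires independence to pass from single samples to pairs of them.

    The unit ball is given by inequalities on finite point sets, without a Hilbert space and without
    measurability of its elements. Lists of weighted points replace the Hilbert space, with
    Cauchy-Schwarz for their quadratic form; measurability is derived.

    The bad events involve [dhat] alone, so [alpha] can be fixed before the tie-breaking [cl] and
    the threshold [C]. *)

Section Slink.
Context {R : realType} {M : nat}.
Implicit Types (Q Pi : {set {set 'I_M}}) (d delta : 'I_M -> 'I_M -> R).

Lemma partition_setTP Q : reflect
  [/\ finset.set0 \notin Q,
      forall x, exists2 A, A \in Q & x \in A &
      forall x A B, A \in Q -> B \in Q -> x \in A -> x \in B -> A = B]
  (finset.partition Q [set: 'I_M]%SET).
Proof.
apply: (iffP and3P) => [[/eqP cQ tQ Q0]|[Q0 cQ uQ]].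
  split=> // [x|x A B QA QB xA xB].
    have : x \in finset.cover Q by rewrite cQ finset.in_setT.
    by move=> /finset.bigcupP[A QA xA]; exists A.
  by rewrite -(def_pblock tQ QA xA) -(def_pblock tQ QB xB).
split=> //.
  apply/eqP/finset.setP => x; rewrite finset.in_setT; apply/finset.bigcupP.
  by have [A QA xA] := cQ x; exists A.
apply/finset.trivIsetP => A B QA QB; rewrite -finset.setI_eq0; apply: contraNT.
by move=> /set0Pn[x]; rewrite finset.in_setI => /andP[xA xB]; exact/eqP/(uQ x).
Qed.

Definition refines Q Pi := forall A, A \in Q -> exists2 B, B \in Pi & A \subset B.

(** For a part of a refinement the pick succeeds, so the default is never returned. *)
Definition block_above Pi (A : {set 'I_M}) : {set 'I_M} :=
  odflt finset.set0 [pick B in Pi | A \subset B].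

Lemma block_aboveP Q Pi A : refines Q Pi -> A \in Q ->
  block_above Pi A \in Pi /\ A \subset block_above Pi A.
Proof.
move=> rQ QA; rewrite /block_above; case: pickP => [B /andP[]//|].
by have [B PB AB] := rQ _ QA => /(_ B); rewrite PB AB.
Qed.

(** Sending a part to the block above it is onto, since a block is nonempty and its points lie in
    parts of [Q]; equal cardinals make it injective. So a block has a single part below it, which
    must fill it. *)
Lemma refines_same_card Q Pi :
  finset.partition Q [set: 'I_M]%SET -> finset.partition Pi [set: 'I_M]%SET ->
  refines Q Pi -> #|Q| = #|Pi| -> Q = Pi.
Proof.
move=> /partition_setTP[Q0 cQ uQ] /partition_setTP[P0 cP uP] rQ cardQ.
have imQ : (block_above Pi @: Q)%SET = Pi.
  apply/finset.setP => B; apply/imsetP/idP => [[A QA ->]|PB].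
    by have [] := block_aboveP rQ QA.
  have /set0Pn[x xB] : B != finset.set0 by apply: contraNneq P0 => <-.
  have [A QA xA] := cQ x; exists A => //.
  have [PA AA] := block_aboveP rQ QA.
  by apply: (uP x) => //; exact: (fintype.subsetP AA).
have /imset_injP inj : #|(block_above Pi @: Q)%SET| == #|Q| by rewrite imQ cardQ.
apply/eqP; rewrite eqEcard cardQ leqnn andbT; apply/fintype.subsetP => A QA.
have [PA AA] := block_aboveP rQ QA.
rewrite (_ : A = block_above Pi A)//; apply/eqP; rewrite finset.eqEsubset AA.
apply/fintype.subsetP => x xA; have [A' QA' xA'] := cQ x.
have [PA' AA'] := block_aboveP rQ QA'.
by rewrite (inj A A') //; apply: (uP x) => //; exact: (fintype.subsetP AA').
Qed.

Lemma inter_min_le d Pi A B i j : (forall i j, 0 <= d i j) ->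
  A \in Pi -> B \in Pi -> A != B -> i \in A -> j \in B -> inter_min d Pi <= d i j.
Proof.
move=> d0 PA PB AB iA jB; apply: ge_inf; last by exists i, j, A, B.
by exists 0 => _ [i' [j' [? [? [_ ->]]]]].
Qed.

(** Two blocks are required because the infimum of the empty set is 0 by convention. *)
Lemma inter_min_ge d Pi c : finset.partition Pi [set: 'I_M]%SET -> (1 < #|Pi|)%N ->
  (forall A B i j, A \in Pi -> B \in Pi -> A != B -> i \in A -> j \in B ->
    c <= d i j) -> c <= inter_min d Pi.
Proof.
move=> /partition_setTP[P0 _ _] /card_gt1P[A [B [PA PB AB]]] cd.
apply: lb_le_inf; last first.
  by move=> _ [i' [j' [A' [B' [[? ? ? ? ?] ->]]]]]; exact: (cd A' B').
have /set0Pn[x xA] : A != finset.set0 by apply: contraNneq P0 => <-.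
have /set0Pn[y yB] : B != finset.set0 by apply: contraNneq P0 => <-.
by exists (d x y), x, y, A, B.
Qed.

Lemma linkage_le delta (A B : {set 'I_M}) i j : (forall i j, 0 <= delta i j) ->
  i \in A -> j \in B -> linkage delta A B <= delta i j.
Proof.
move=> d0 iA jB; apply: ge_inf; last by exists i => //; exists j.
by exists 0 => _ [i' _ [j' _ <-]].
Qed.

Lemma linkage_lt delta (A B : {set 'I_M}) c : A != finset.set0 -> B != finset.set0 ->
  linkage delta A B < c -> exists i j, [/\ i \in A, j \in B & delta i j < c].
Proof.
move=> /set0Pn[x xA] /set0Pn[y yB] /inf_lt[].
  by exists (delta x y), x => //; exists y.
by move=> _ [i iA [j jB <-]] dc; exists i, j.
Qed.

Lemma d_I_ge0 d Pi : 0 <= d_I d Pi.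
Proof. by rewrite /d_I bigmax_idl le_max lexx. Qed.

Lemma linkage_le_d_I d Pi (A B : {set 'I_M}) : (forall i j, 0 <= d i j) ->
  B \in Pi -> A \subset B -> A != finset.set0 -> B :\: A != finset.set0 ->
  linkage d A (B :\: A) <= d_I d Pi.
Proof.
move=> d0 PB AB A0 BA0.
apply: le_trans (@le_bigmax_cond _ _ _ 0 B (mem Pi) (d_I_block d) PB).
have cA : (0 < #|A|)%N by rewrite card_gt0.
have cBA : (0 < #|B :\: A|)%N by rewrite card_gt0.
have cB : (1 < #|B|)%N by rewrite -(cardsID A B) (finset.setIidPr AB); lia.
rewrite /d_I_block leqNgt cB /=; apply: ub_le_sup; last by exists A.
(* The sum of all dissimilarities is a crude upper bound, enough for the supremum to be
   meaningful. *)
exists (\sum_i \sum_j d i j) => _ [B1 [_ + +] <-].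
rewrite !card_gt0 => /set0Pn[i iB] /set0Pn[j jB].
apply: le_trans (linkage_le d0 iB jB) _.
rewrite (bigD1 i)//= (bigD1 j)//= -addrA lerDl addr_ge0//.
  by rewrite sumr_ge0.
by rewrite sumr_ge0// => ? _; rewrite sumr_ge0.
Qed.

Variables (d delta : 'I_M -> 'I_M -> R) (Pi : {set {set 'I_M}}) (eta : R).
Hypothesis Pi_part : finset.partition Pi [set: 'I_M]%SET.
Hypothesis d_ge0 : forall i j, 0 <= d i j.
Hypothesis delta_ge0 : forall i j, 0 <= delta i j.
(** Only distinct indices are compared, since the concentration bound is for two independent
    sequences. *)
Hypothesis delta_close : forall i j, i != j -> `|delta i j - d i j| < eta.
Hypothesis separated : d_I d Pi + 3 * eta < d_H d Pi.

(** With more parts than blocks, two parts lie in one block [C]. Cutting [C] along the first of them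
    yields a true distance at most [d_I], hence an estimated link below [d_I + 2 * eta]. A minimal
    merge across two blocks would be at least as short, while its true distance is at least [d_H];
    this contradicts [separated]. *)
Lemma slink_step_refines Q Q' : finset.partition Q [set: 'I_M]%SET ->
  refines Q Pi -> (#|Pi| < #|Q|)%N -> slink_step delta Q Q' ->
  finset.partition Q' [set: 'I_M]%SET /\ refines Q' Pi.
Proof.
move=> /partition_setTP[Q0 cQ uQ] rQ cardQ [A [B [QA QB AB minAB ->]]].
have /partition_setTP[P0 cP uP] := Pi_part.
have neQ C : C \in Q -> C != finset.set0 by move=> QC; apply: contraNneq Q0 => <-.
have [C [PC AC BC]] : exists C, [/\ C \in Pi, A \subset C & B \subset C].
  have [PA AA] := block_aboveP rQ QA; have [PB BB] := block_aboveP rQ QB.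
  have [eqAB|neAB] := eqVneq (block_above Pi A) (block_above Pi B).
    by exists (block_above Pi A); split; rewrite // eqAB.
  exfalso.
  have : exists A' B', [/\ A' \in Q, B' \in Q, A' != B' &
      linkage delta A' B' < d_I d Pi + 2 * eta].
    have : ~~ dinjectiveb (block_above Pi) (mem Q).
      apply/negP => /dinjectiveP inj.
      have := card_in_imset inj; apply/eqP; rewrite neq_ltn.
      suff /subset_leq_card h : (block_above Pi @: Q)%SET \subset Pi.
        by rewrite (leq_ltn_trans h cardQ).
      by apply/fintype.subsetP => _ /imsetP[D QD ->]; have [] := block_aboveP rQ QD.
    move=> /dinjectivePn[A1 QA1 [A2 /andP[A12 QA2] eqA12]].
    have [PA1 AA1] := block_aboveP rQ QA1; have [_ AA2] := block_aboveP rQ QA2.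
    set C := block_above Pi A1 in eqA12 PA1 AA1.
    have CA10 : C :\: A1 != finset.set0.
      have /set0Pn[x xA2] := neQ _ QA2; apply/set0Pn; exists x.
      rewrite finset.in_setD eqA12 (fintype.subsetP AA2)// andbT.
      by apply: contra A12 => xA1; apply/eqP/(uQ x).
    have [i [j [iA1]]] : exists i j, [/\ i \in A1, j \in C :\: A1 &
        d i j < d_I d Pi + eta].
      apply: linkage_lt => //; first exact: neQ.
      apply: le_lt_trans (linkage_le_d_I d_ge0 PA1 AA1 (neQ _ QA1) CA10) _.
      (* Positivity of [eta] comes from closeness at a pair with one point in [A1] and one
         outside. *)
      rewrite ltrDl; have /set0Pn[x xA1] := neQ _ QA1.
      have /set0Pn[y] := CA10; rewrite finset.in_setD => /andP[yA1 _].
      apply: le_lt_trans (normr_ge0 (delta x y - d x y)) (delta_close _).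
      by apply: contraNneq yA1 => <-.
    rewrite finset.in_setD => /andP[jA1 jC] dij.
    (* The point [j] may lie outside [A2]; its own part differs from [A1], and that is enough. *)
    have [B1 QB1 jB1] := cQ j; exists A1, B1; split=> //.
      by apply: contraNneq jA1 => ->.
    apply: le_lt_trans (linkage_le delta_ge0 iA1 jB1) _.
    have /delta_close : i != j by apply: contraNneq jA1 => <-.
    by rewrite ltr_norml => /andP[_]; lra.
  move=> [A' [B' [QA' QB' AB' lAB']]].
  have /(linkage_lt (neQ _ QA) (neQ _ QB)) [i [j [iA jB]]] :=
    le_lt_trans (minAB _ _ QA' QB' AB') lAB'.
  have iC := fintype.subsetP AA _ iA; have jC := fintype.subsetP BB _ jB.
  have := inter_min_le d_ge0 PA PB neAB iC jC.
  have /delta_close : i != j.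
    by apply: contraNneq neAB => ij; apply/eqP/(uP i) => //; rewrite ij.
  rewrite ltr_norml => /andP[+ _]; move: separated; rewrite /d_H; lra.
have QE D : D \in (Q :\ A :\ B :|: [set A :|: B])%SET ->
    [/\ D \in Q, D != A & D != B] \/ D = A :|: B.
  by rewrite !inE => /orP[/and3P[]|/eqP]; [left|right].
split; last first.
  move=> D /QE[[QD _ _]|->]; first exact: rQ.
  by exists C => //; rewrite finset.subUset AC.
apply/partition_setTP; split.
- apply/negP => /QE[[]|]; first by rewrite (negbTE Q0).
  move=> /esym/eqP; rewrite finset.setU_eq0 => /andP[+ _].
  by apply/negP; exact: neQ.
- move=> x; have [D QD xD] := cQ x.
  have [DA|DA] := eqVneq D A.
    by exists (A :|: B); rewrite !inE ?eqxx ?orbT// -DA xD.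
  have [DB|DB] := eqVneq D B.
    by exists (A :|: B); rewrite !inE ?eqxx ?orbT// -DB xD orbT.
  by exists D => //; rewrite !inE DA DB QD.
- have uni D x : D \in Q -> D != A -> D != B -> x \in D -> x \in A :|: B -> False.
    move=> QD DA DB xD; rewrite finset.in_setU => /orP[xA|xB].
      by move: DA; rewrite (uQ x D A)// eqxx.
    by move: DB; rewrite (uQ x D B)// eqxx.
  move=> x D E /QE[[QD DA DB]|->] /QE[[QE' EA EB]|->]// xD xE.
  + exact: (uQ x).
  + by case: (uni D x).
  + by case: (uni E x).
Qed.

Lemma slink_output_correct Q : slink_output delta #|Pi| Q -> Q = Pi.
Proof.
move=> [rch cardQ].
suff [] : finset.partition Q [set: 'I_M]%SET /\ refines Q Pi.
  by move=> pQ rQ; exact: refines_same_card.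
elim: rch {cardQ} => [|Q1 Q2 _ [pQ rQ] cQ step]; last exact: slink_step_refines step.
split.
  apply/partition_setTP; split.
  - by apply/imsetP => -[x _ /esym/eqP]; apply/negP/finset.set0Pn; exists x; rewrite inE.
  - by move=> x; exists [set x]%SET; [exact: imset_f|rewrite inE].
  - by move=> x _ _ /imsetP[y _ ->] /imsetP[z _ ->]; rewrite !inE => /eqP<- /eqP<-.
have /partition_setTP[_ cP _] := Pi_part.
move=> _ /imsetP[x _ ->]; have [B PB xB] := cP x.
by exists B => //; rewrite finset.sub1set.
Qed.

Lemma inter_min_close : (1 < #|Pi|)%N -> d_H d Pi - eta <= inter_min delta Pi.
Proof.
move=> P1; apply: inter_min_ge => // A B i j PA PB AB iA jB.
have /partition_setTP[_ _ uP] := Pi_part.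
have := inter_min_le d_ge0 PA PB AB iA jB; rewrite /d_H.
have /delta_close : i != j.
  by apply: contraNneq AB => ij; apply/eqP/(uP i) => //; rewrite ij.
by rewrite ltr_norml => /andP[+ _]; lra.
Qed.

End Slink.

(** * Independence *)

Section Independence.
Context {R : realType} {dO : measure_display} {Omega : measurableType dO}.
Variable P : probability Omega R.
Local Open Scope ereal_scope.

(** With [c] the inverse of [P E] this is the conditional law of [V] given [E]; being a measure, it
    is subject to the uniqueness of product measures. *)
Lemma cond_law_exists d (T : measurableType d) (E : set Omega) (V : Omega -> T) (c : R) :
  measurable E -> measurable_fun setT V -> (0 <= c)%R ->
  exists m : {measure set T -> \bar R}, forall S, m S = c%:E * P (E `&` V @^-1` S).
Proof.
move=> mE mV c0.
unshelve refine (@ex_intro {measure set T -> \bar R}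
  (fun m => forall S, m S = c%:E * P (E `&` V @^-1` S))
  (mscale (NngNum c0) (pushforward (mrestr P mE) V)) _) => // S.
by rewrite /mscale /= /pushforward /mrestr setIC.
Qed.

Lemma law_exists d (T : measurableType d) (V : Omega -> T) :
  measurable_fun setT V ->
  exists m : probability T R, forall S, m S = P (V @^-1` S).
Proof.
move=> mV; pose V' : {mfun Omega >-> T} := mfun_Sub (mem_set mV).
by exists (distribution P V').
Qed.

Lemma ge0_integral_law d (T : measurableType d) (V : Omega -> T)
    (m : {measure set T -> \bar R}) (phi : T -> R) :
  measurable_fun setT V -> (forall S, measurable S -> m S = P (V @^-1` S)) ->
  measurable_fun setT phi -> (forall x, 0 <= phi x)%R ->
  \int[P]_w (phi (V w))%:E = \int[m]_x (phi x)%:E.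
Proof.
move=> mV mE mphi phi0.
pose V' : {mfun Omega >-> T} := mfun_Sub (mem_set mV).
rewrite (@eq_measure_integral _ _ _ setT (pushforward P V')); last first.
  by move=> A mA _; rewrite mE.
rewrite ge0_integral_pushforward//; last by move=> x _; rewrite lee_fin.
exact/measurable_EFinP.
Qed.

Section Pair.
Context d1 d2 (T1 : measurableType d1) (T2 : measurableType d2).
Variables (U : Omega -> T1) (V : Omega -> T2).
Hypotheses (mU : measurable_fun setT U) (mV : measurable_fun setT V).
Variables (m1 : probability T1 R) (m2 : probability T2 R).

(** The conditional law of the pair given [E] agrees with the product measure on rectangles, hence
    everywhere; a null [E] makes both sides vanish. The event [E] lets inductions carry along the
    other variables of a family. *)
Lemma pair_law (E : set Omega) : measurable E ->
  (forall A B, measurable A -> measurable B ->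
     P (E `&` (U @^-1` A `&` V @^-1` B)) = P E * (m1 A * m2 B)) ->
  forall S, measurable S ->
    P (E `&` (fun w => (U w, V w)) @^-1` S) = P E * (m1 \x m2) S.
Proof.
move=> mE rect S mS.
have mUV : measurable_fun setT (fun w => (U w, V w)) by exact: measurable_fun_pair.
have mES : measurable (E `&` (fun w => (U w, V w)) @^-1` S).
  by apply: measurableI => //; rewrite -[X in measurable X]setTI; exact: mUV.
have [PE0|PE0] := eqVneq (P E) 0.
  rewrite PE0 mul0e; apply/eqP; rewrite eq_le measure_ge0 andbT -PE0.
  by apply: le_measure; rewrite ?inE.
have PEfin : P E \is a fin_num by exact: fin_num_measure.
have PEc : (fine (P E))^-1%:E * P E = 1.
  rewrite -{2}(fineK PEfin) -EFinM mulVf// -eqe fineK//.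
have c0 : (0 <= (fine (P E))^-1)%R by rewrite invr_ge0 fine_ge0.
have [m' m'E] := cond_law_exists mE mUV c0.
have rect' A B : measurable A -> measurable B -> m' (A `*` B) = m1 A * m2 B.
  by move=> mA mB; rewrite m'E rect// muleA PEc mul1e.
rewrite (product_measure_unique rect' mS) m'E muleA [P E * _]muleC PEc mul1e//.
Qed.

End Pair.

(** Stated along a fixed list, with iterated operators and extended reals, as suits induction on the
    list. *)
Definition indep {I : Type} {d} {T : measurableType d} (X : I -> Omega -> T) (s : seq I) :=
  forall B : I -> set T, (forall i, measurable (B i)) ->
  P (\big[setI/setT]_(i <- s) X i @^-1` B i) = \prod_(i <- s) P (X i @^-1` B i).

Lemma mutually_independentP {I : eqType} {d} {T : measurableType d} (X : I -> Omega -> T) :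
  (forall i, measurable_fun setT (X i)) ->
  mutually_independent P X -> forall s, uniq s -> indep X s.
Proof.
move=> mX iX s us B mB.
have mXB i : measurable (X i @^-1` B i) by rewrite -[X in measurable X]setTI; exact: mX.
have := iX s B us mB.
rewrite (_ : \bigcap_(i in _) _ = \big[setI/setT]_(i <- s) X i @^-1` B i) => [e|]; last first.
  elim: s {us} => [|i s IH]; first by rewrite big_nil set_nil bigcap_set0.
  by rewrite big_cons -IH; apply/seteqP; split=> [w h|w [hi h] j /=];
    [split=> [|j js]; apply: h; rewrite /= inE ?eqxx ?js ?orbT|
     rewrite inE => /predU1P[->//|]; exact: h].
rewrite -[LHS]fineK; last by apply: fin_num_measure; exact: bigsetI_measurable.
rewrite e -prodEFin; apply: eq_bigr => i _.
by rewrite fineK//; exact: fin_num_measure.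
Qed.

Section Pairing.
Context {J : eqType} d1 d2 (T1 : measurableType d1) (T2 : measurableType d2).
Variables (U : J -> Omega -> T1) (V : J -> Omega -> T2).
Hypotheses (mU : forall j, measurable_fun setT (U j)).
Hypotheses (mV : forall j, measurable_fun setT (V j)).

Let rect (A : J -> set T1) (C : J -> set T2) j := U j @^-1` A j `&` V j @^-1` C j.
Let UV j w := (U j w, V j w).

Lemma measurable_rect A C j : measurable (A j) -> measurable (C j) ->
  measurable (rect A C j).
Proof.
move=> mA mC; apply: measurableI.
  by rewrite -[X in measurable X]setTI; exact: mU.
by rewrite -[X in measurable X]setTI; exact: mV.
Qed.

(** Rectangles are replaced by arbitrary sets of the product space one index at a time, by
    [pair_law]; in [H] below, the event [E] collects the sets already put in place. *)
Lemma indep_pair (r : seq J) : uniq r ->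
  (forall A C, (forall j, measurable (A j)) -> (forall j, measurable (C j)) ->
    P (\big[setI/setT]_(j <- r) rect A C j) =
    \prod_(j <- r) (P (U j @^-1` A j) * P (V j @^-1` C j))) ->
  indep UV r.
Proof.
move=> ur hr S mS.
have pT d (T : measurableType d) (W : Omega -> T) : P (W @^-1` setT) = 1.
  by rewrite preimage_setT probability_setT.
have mUV j : measurable_fun setT (UV j) by exact: measurable_fun_pair.
have mUVS j : measurable (UV j @^-1` S j).
  by rewrite -[X in measurable X]setTI; exact: mUV.
have pair2 j A C : j \in r -> measurable A -> measurable C ->
    P (U j @^-1` A `&` V j @^-1` C) = P (U j @^-1` A) * P (V j @^-1` C).
  move=> jr mA mC.
  have := hr (fun i => if i == j then A else setT) (fun i => if i == j then C else setT).
  rewrite (bigD1_seq j)//= [in RHS](bigD1_seq j)//= /rect eqxx.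
  rewrite big1; last by move=> i /negbTE ->; rewrite !preimage_setT setTI.
  rewrite [X in _ = _ * X]big1; last by move=> i /negbTE ->; rewrite !pT mule1.
  by rewrite setIT mule1; apply => i; case: ifP.
suff H (E : set Omega) : measurable E ->
  (forall A C, (forall j, measurable (A j)) -> (forall j, measurable (C j)) ->
    P (E `&` \big[setI/setT]_(j <- r) rect A C j) =
    P E * \prod_(j <- r) (P (U j @^-1` A j) * P (V j @^-1` C j))) ->
  P (E `&` \big[setI/setT]_(j <- r) UV j @^-1` S j) =
    P E * \prod_(j <- r) P (UV j @^-1` S j).
  have := H setT measurableT; rewrite !setTI probability_setT mul1e; apply => A C mA mC.
  by rewrite setTI mul1e hr.
elim: r ur pair2 {hr} E => [|j r IH] /= ur pair2 E mE hE.
  by rewrite !big_nil setIT mule1.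
have /andP[jr ur'] := ur.
have [m1 m1E] := law_exists (mU j); have [m2 m2E] := law_exists (mV j).
have step F : measurable F ->
    (forall A C, measurable A -> measurable C ->
      P (F `&` (U j @^-1` A `&` V j @^-1` C)) =
      P F * (P (U j @^-1` A) * P (V j @^-1` C))) ->
    P (F `&` UV j @^-1` S j) = P F * (m1 \x m2) (S j).
  move=> mF hF; apply: pair_law => // A C mA mC.
  by rewrite hF// m1E m2E.
have PS : P (UV j @^-1` S j) = (m1 \x m2) (S j).
  have := step setT measurableT; rewrite setTI probability_setT mul1e; apply => A C mA mC.
  by rewrite setTI mul1e pair2// mem_head.
have hF A C : (forall j, measurable (A j)) -> (forall j, measurable (C j)) ->
    P (E `&` \big[setI/setT]_(j <- r) rect A C j `&` UV j @^-1` S j) =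
    P E * \prod_(j <- r) (P (U j @^-1` A j) * P (V j @^-1` C j)) * (m1 \x m2) (S j).
  move=> mA mC; set F := \big[setI/setT]_(j <- r) _.
  have hEF A' C' : measurable A' -> measurable C' ->
      P (E `&` F `&` (U j @^-1` A' `&` V j @^-1` C')) =
      P E * \prod_(j <- r) (P (U j @^-1` A j) * P (V j @^-1` C j)) *
      (P (U j @^-1` A') * P (V j @^-1` C')).
    move=> mA' mC'.
    (* The rectangle of index [j] is a free choice in [hE]; the others stay fixed. *)
    have := hE (fun i => if i == j then A' else A i) (fun i => if i == j then C' else C i).
    rewrite !big_cons /rect eqxx.
    rewrite (_ : \big[setI/setT]_(i <- r) _ = F); last first.
      apply: eq_big_seq => i ir; case: eqP => [ij|]//.
      by move: jr; rewrite -ij ir.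
    rewrite (_ : \prod_(i <- r) _ =
       \prod_(j <- r) (P (U j @^-1` A j) * P (V j @^-1` C j))); last first.
      apply: eq_big_seq => i ir; case: eqP => [ij|]//.
      by move: jr; rewrite -ij ir.
    rewrite -[X in _ -> P X = _]setIA [X in _ -> P (_ `&` X) = _]setIC => ->; last 2 first.
    - by move=> i; case: ifP.
    - by move=> i; case: ifP.
    by rewrite [X in P E * X]muleC muleA.
  have mF : measurable F.
    by apply: bigsetI_measurable => i _; exact: measurable_rect.
  have PEF : P (E `&` F) = P E * \prod_(j <- r) (P (U j @^-1` A j) * P (V j @^-1` C j)).
    have := hEF setT setT measurableT measurableT.
    by rewrite !preimage_setT !setIT probability_setT !mule1.
  rewrite -PEF; apply: step; first exact: measurableI.
  by move=> A' C' mA' mC'; rewrite PEF hEF.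
rewrite !big_cons setIA.
have PE' : P (E `&` UV j @^-1` S j) = P E * (m1 \x m2) (S j).
  have := hF (fun=> setT) (fun=> setT).
  rewrite !big1; last 2 first.
  - by move=> i _; rewrite !pT mule1.
  - by move=> i _; rewrite /rect !preimage_setT setTI.
  by rewrite setIT mule1; apply.
rewrite IH//; last 3 first.
- by move=> i A C ir; apply: pair2; rewrite inE ir orbT.
- by apply: measurableI.
- move=> A C mA mC.
  rewrite -setIA [_ `&` \big[_/_]_(_ <- _) _]setIC setIA hF// PE'.
  by rewrite -!muleA; congr (_ * _); rewrite muleC.
by rewrite PE' PS muleA.
Qed.

End Pairing.

Lemma indep_pairing {I J : eqType} {d} {T : measurableType d} (X : I -> Omega -> T)
    (f g : J -> I) (r : seq J) :
  (forall i, measurable_fun setT (X i)) ->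
  (forall s, uniq s -> indep X s) -> uniq (map f r ++ map g r) ->
  indep (fun j w => (X (f j) w, X (g j) w)) r.
Proof.
move=> mX iX ufg; have := ufg; rewrite cat_uniq => /and3P[uf /hasPn nfg ug].
have [->|] := eqVneq r [::]; first by move=> B _; rewrite !big_nil probability_setT.
rewrite -size_eq0 -lt0n => r0; have j0 : J by case: (r) r0.
apply: indep_pair => //; first exact: map_uniq uf.
move=> A C mA mC.
(* [inv h] recovers [j] from [h j], so that [A] and [C] can be attached to indices of [X];
   disjointness of the two images makes [B] below consistent. *)
pose inv (h : J -> I) i := nth j0 r (index i (map h r)).
have invK (h : J -> I) j : uniq (map h r) -> j \in r -> inv h (h j) = j.
  move=> uh jr; rewrite /inv -(nth_index j0 jr) -(nth_map _ (h j0)) ?index_mem//.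
  by rewrite index_uniq// size_map index_mem.
pose B i := if i \in map f r then A (inv f i) else C (inv g i).
have := iX _ ufg B; rewrite !big_cat !big_map.
rewrite (eq_big_seq (fun j => X (f j) @^-1` A j)); last first.
  by move=> j jr; rewrite /B map_f// invK.
rewrite [X in P (_ `&` X)](eq_big_seq (fun j => X (g j) @^-1` C j)); last first.
  move=> j jr; rewrite /B (negbTE (nfg _ _)) ?map_f// invK//.
rewrite [X in _ = X * _](eq_big_seq (fun j => P (X (f j) @^-1` A j))); last first.
  by move=> j jr; rewrite /B map_f// invK.
rewrite [X in _ = _ * X](eq_big_seq (fun j => P (X (g j) @^-1` C j))); last first.
  move=> j jr; rewrite /B (negbTE (nfg _ _)) ?map_f// invK//.
by rewrite -!big_split; apply=> i; rewrite /B; case: ifP.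
Qed.

Lemma indep_comp {I : Type} {d d'} {T : measurableType d} {T' : measurableType d'}
    (X : I -> Omega -> T) (phi : T -> T') s : measurable_fun setT phi ->
  indep X s -> indep (fun i w => phi (X i w)) s.
Proof.
move=> mphi iX B mB; have := iX (fun i => phi @^-1` B i); apply => i.
by rewrite -[X in measurable X]setTI; exact: mphi.
Qed.

Lemma integral_expR_sum_indep {J : eqType} (Y : J -> Omega -> R) (r : seq J) :
  (forall j, measurable_fun setT (Y j)) -> uniq r -> indep Y r ->
  \int[P]_w (expR (\sum_(j <- r) Y j w))%:E = \prod_(j <- r) \int[P]_w (expR (Y j w))%:E.
Proof.
move=> mY ur iY.
(* [U] is the partial sum already formed. To move [Y j] into it, the law of [(U, Y j)] given the
   remaining variables is shown to be a product; Tonelli then separates the two exponentials. *)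
suff H (U : Omega -> R) : measurable_fun setT U ->
    (forall A (B : J -> set R), measurable A -> (forall j, measurable (B j)) ->
      P (U @^-1` A `&` \big[setI/setT]_(j <- r) Y j @^-1` B j) =
      P (U @^-1` A) * \prod_(j <- r) P (Y j @^-1` B j)) ->
    \int[P]_w (expR (U w + \sum_(j <- r) Y j w))%:E =
    \int[P]_w (expR (U w))%:E * \prod_(j <- r) \int[P]_w (expR (Y j w))%:E.
  have := H (cst 0%R) (measurable_cst _).
  under eq_integral do rewrite /cst add0r; move=> ->.
    under eq_integral do rewrite /cst expR0.
    suff -> : \int[P]_w (1%R)%:E = 1 by rewrite mul1e.
    by rewrite (integral_cst P measurableT) mul1e; exact: probability_setT.
  move=> A B mA mB; rewrite preimage_cst; case: ifP => _.
    by rewrite setTI probability_setT mul1e iY.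
  by rewrite set0I measure0 mul0e.
elim: r ur {iY} U => [_|j r IH /= /andP[jr ur]] U mU hU.
  by under eq_integral do rewrite big_nil addr0; rewrite big_nil mule1.
have [m1 m1E] := law_exists mU; have [m2 m2E] := law_exists (mY j).
have mYB i (B : set R) : measurable B -> measurable (Y i @^-1` B).
  by move=> mB; rewrite -[X in measurable X]setTI; exact: mY.
have hF A C (B : J -> set R) : measurable A -> measurable C -> (forall j, measurable (B j)) ->
    P (\big[setI/setT]_(i <- r) Y i @^-1` B i `&` (U @^-1` A `&` Y j @^-1` C)) =
    \prod_(i <- r) P (Y i @^-1` B i) * (m1 A * m2 C).
  move=> mA mC mB; have := hU A (fun i => if i == j then C else B i) mA.
  rewrite !big_cons eqxx.
  rewrite (eq_big_seq (fun i => Y i @^-1` B i)); last first.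
    by move=> i ir; case: eqP => [ij|]//; move: jr; rewrite -ij ir.
  rewrite [X in _ = _ * (_ * X)](eq_big_seq (fun i => P (Y i @^-1` B i))); last first.
    by move=> i ir; case: eqP => [ij|]//; move: jr; rewrite -ij ir.
  rewrite setIA setIC m1E m2E => ->; last by move=> i; case: ifP.
  by rewrite muleA muleC.
have hF1 (B : J -> set R) : (forall j, measurable (B j)) ->
    P (\big[setI/setT]_(i <- r) Y i @^-1` B i) = \prod_(i <- r) P (Y i @^-1` B i).
  move=> mB; have := hF setT setT B measurableT measurableT mB.
  by rewrite !preimage_setT !setIT !probability_setT !mule1.
have hS (B : J -> set R) S : (forall j, measurable (B j)) -> measurable S ->
    P (\big[setI/setT]_(i <- r) Y i @^-1` B i `&` (fun w => (U w, Y j w)) @^-1` S) =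
    \prod_(i <- r) P (Y i @^-1` B i) * (m1 \x m2) S.
  move=> mB mS; rewrite -hF1//; apply: pair_law => //.
    by apply: bigsetI_measurable => i _; exact: mYB.
  by move=> A C mA mC; rewrite hF// hF1.
have hS1 S : measurable S -> (m1 \x m2) S = P ((fun w => (U w, Y j w)) @^-1` S).
  move=> mS; have := hS (fun=> setT) S (fun=> measurableT) mS.
  rewrite !big1; last 2 first.
  - by move=> i _; rewrite preimage_setT probability_setT.
  - by move=> i _; rewrite preimage_setT.
  by rewrite setTI mul1e.
under eq_integral do rewrite big_cons addrA.
have mUY : measurable_fun setT (fun w => U w + Y j w)%R by exact: measurable_funD.
rewrite (IH ur (fun w => U w + Y j w)%R)//; last first.
  move=> A B mA mB.
  have mS : measurable ((fun z : R * R => z.1 + z.2)%R @^-1` A).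
    rewrite -[X in measurable X]setTI.
    by apply: measurable_funD; [exact: measurable_fst|exact: measurable_snd|exact: measurableT|].
  rewrite setIC (hS B _ mB mS) hS1// muleC//.
rewrite big_cons muleA; congr (_ * _).
have mphi : measurable_fun setT (fun z : R * R => expR z.1 * expR z.2)%R.
  by apply: measurable_funM; apply: measurableT_comp => //.
have mUYp : measurable_fun setT (fun w => (U w, Y j w)) by exact: measurable_fun_pair.
under eq_integral do rewrite expRD.
rewrite (@ge0_integral_law _ _ (fun w => (U w, Y j w)) (m1 \x m2)%E
   (fun z : R * R => expR z.1 * expR z.2)%R) //.
rewrite fubini_tonelli1//; last exact/measurable_EFinP.
rewrite /fubini_F /=.
have e1 : \int[P]_w (expR (U w))%:E = \int[m1]_x (expR x)%:E.
  by apply: (@ge0_integral_law _ _ U m1 expR) => // S _; exact: m1E.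
have e2 : \int[P]_w (expR (Y j w))%:E = \int[m2]_x (expR x)%:E.
  by apply: (@ge0_integral_law _ _ (Y j) m2 expR) => // S _; exact: m2E.
rewrite e1 e2; under eq_integral => x _.
  under eq_integral => y _ do rewrite EFinM.
  rewrite ge0_integralZl//; last exact/measurable_EFinP.
  over.
rewrite /= ge0_integralZr//; first exact/measurable_EFinP.
by apply: integral_ge0 => y _; rewrite lee_fin expR_ge0.
Qed.

End Independence.

(** * Bounded random variables and the Chernoff bound *)

Lemma measurable_set_ge {R : realType} {d : measure_display} {T : measurableType d}
    (F : T -> R) (a : R) : measurable_fun setT F -> measurable [set w | a <= F w].
Proof.
move=> mF; rewrite -[X in measurable X]setTI.
rewrite (_ : [set w | _] = F @^-1` `[a, +oo[%classic); first exact: mF.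
by apply/seteqP; split => w /=; rewrite in_itv/= andbT.
Qed.

Section BoundedIntegral.
Context {R : realType} {d : measure_display} {T : measurableType d}.
Variable P : probability T R.
Implicit Types f g : T -> R.

Lemma integrable_bounded f (B : R) : measurable_fun setT f -> (forall x, `|f x| <= B) ->
  P.-integrable setT (EFin \o f).
Proof.
move=> mf fB; apply: (@le_integrable _ _ _ P setT measurableT _ (EFin \o cst B)).
- exact/measurable_EFinP.
- by move=> x _ /=; rewrite lee_fin (le_trans (fB x))// ler_norm.
- exact: finite_measure_integrable_cst.
Qed.

Lemma EFin_Rintegral f : P.-integrable setT (EFin \o f) ->
  (\int[P]_x (f x)%:E)%E = (\int[P]_x f x)%:E.
Proof. by move=> fi; rewrite fineK//; exact: integrable_fin_num. Qed.

Lemma Rintegral_cst1 (c : R) : \int[P]_x c = c.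
Proof.
rewrite (Rintegral_cst P measurableT) -[RHS]mulr1; congr (_ * _).
exact: (congr1 fine (probability_setT P)).
Qed.

Lemma Rintegral_sum_seq {I : Type} (s : seq I) (F : I -> T -> R) :
  (forall i, P.-integrable setT (EFin \o F i)) ->
  \int[P]_x (\sum_(i <- s) F i x) = \sum_(i <- s) \int[P]_x F i x.
Proof.
move=> Fi; elim: s => [|i s IH].
  by rewrite big_nil; under eq_Rintegral do rewrite big_nil; exact: Rintegral_cst1.
rewrite big_cons -IH -RintegralD//; first by apply: eq_Rintegral => x _; rewrite big_cons.
rewrite (_ : _ \o _ = fun x => (\sum_(i <- s) (EFin \o F i) x)%E); last first.
  by apply/funext => x /=; rewrite sumEFin.
by apply: integrable_sum => // j _.
Qed.

Lemma Rintegral_norm_le f (B : R) : measurable_fun setT f -> (forall x, `|f x| <= B) ->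
  `|\int[P]_x f x| <= B.
Proof.
move=> mf fB; have fi := integrable_bounded mf fB.
apply: le_trans (le_normr_Rintegral measurableT fi) _.
rewrite -[leRHS]Rintegral_cst1; apply: le_Rintegral => //.
  by apply: (@integrable_bounded _ B) => [|x]; [exact: measurableT_comp|rewrite normr_id].
exact: finite_measure_integrable_cst.
Qed.

(** Jensen's inequality, by integrating the tangent bound [2 * m * f x - m ^+ 2 <= f x ^+ 2] at the
    mean [m]. *)
Lemma sqr_Rintegral_le f (B : R) : measurable_fun setT f -> (forall x, `|f x| <= B) ->
  (\int[P]_x f x) ^+ 2 <= \int[P]_x (f x ^+ 2).
Proof.
move=> mf fB; have fi := integrable_bounded mf fB; set m := \int[P]_x f x.
have f2i : P.-integrable setT (EFin \o (fun x => f x ^+ 2)).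
  apply: (@integrable_bounded _ (B ^+ 2)); first exact: measurable_funX.
  by move=> x; rewrite normrX lerXn2r ?nnegrE// (le_trans _ (fB x)).
have : \int[P]_x (2 * m * f x - m ^+ 2) <= \int[P]_x (f x ^+ 2).
  apply: le_Rintegral => //; last first.
    by move=> x _; rewrite -subr_ge0 (_ : _ - _ = (f x - m) ^+ 2) ?sqr_ge0//; ring.
  apply: (@integrable_bounded _ (`|2 * m| * B + m ^+ 2)).
    by apply: measurable_funB => //; exact: measurable_funM.
  move=> x; rewrite (le_trans (ler_normB _ _))// lerD//.
    by rewrite normrM ler_wpM2l.
  by rewrite ger0_norm// sqr_ge0.
rewrite RintegralB//; last 2 first.
- by apply: (@integrable_bounded _ (`|2 * m| * B)) => [|x];
    [exact: measurable_funM|rewrite normrM ler_wpM2l].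
- exact: finite_measure_integrable_cst.
rewrite RintegralZl// Rintegral_cst1 -/m; nra.
Qed.

End BoundedIntegral.

Section Chernoff.
Context {R : realType} {dO : measure_display} {Omega : measurableType dO}.
Variable P : probability Omega R.

(** From [expR (- x) >= 1 - x] one gets [expR x * (1 - x) <= 1], and the right-hand side times
    [1 - x] is [1 + x ^+ 2 * (1 - 2 * x)], at least 1. *)
Lemma expR_le_quadratic (x : R) : x <= 2^-1 -> expR x <= 1 + x + 2 * x ^+ 2.
Proof.
move=> x2; have h := @expR_ge1Dx R (- x).
have e : expR x * expR (- x) = 1 by rewrite -expRD subrr expR0.
have e0 := expR_gt0 x.
have : expR x * (1 - x) <= 1 by rewrite -[leRHS]e ler_pM2l.
have : 1 <= (1 + x + 2 * x ^+ 2) * (1 - x).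
  have -> : (1 + x + 2 * x ^+ 2) * (1 - x) = 1 + x ^+ 2 * (1 - 2 * x) by ring.
  by rewrite lerDl mulr_ge0 ?sqr_ge0//; lra.
have x1 : 0 < 1 - x by lra.
by move=> h1 h2; rewrite -(ler_pM2r x1); exact: le_trans h2 h1.
Qed.

(** The linear term of the quadratic bound integrates to 0, and
    [1 + 2 * b ^+ 2 <= expR (2 * b ^+ 2)]. *)
Lemma integral_expR_le (Y : Omega -> R) (b : R) : measurable_fun setT Y ->
  (forall w, `|Y w| <= b) -> b <= 2^-1 -> \int[P]_w Y w = 0 ->
  (\int[P]_w (expR (Y w))%:E <= (expR (2 * b ^+ 2))%:E)%E.
Proof.
move=> mY Yb b2 Y0; have Yi := integrable_bounded P mY Yb.
have b0 : 0 <= b by exact: le_trans (normr_ge0 _) (Yb point).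
have ei : P.-integrable setT (EFin \o (fun w => expR (Y w))).
  apply: (@integrable_bounded _ _ _ P _ (expR b)); first exact: measurableT_comp.
  by move=> w; rewrite ger0_norm ?expR_ge0// ler_expR (le_trans (ler_norm _)).
rewrite EFin_Rintegral// lee_fin.
have qi : P.-integrable setT (EFin \o (fun w => 1 + 2 * b ^+ 2 + Y w)).
  apply: (@integrable_bounded _ _ _ P _ (1 + 2 * b ^+ 2 + b)).
    exact: measurable_funD.
  by move=> w; rewrite (le_trans (ler_normD _ _))// lerD// ger0_norm//; nra.
apply: (@le_trans _ _ (\int[P]_w (1 + 2 * b ^+ 2 + Y w))).
  apply: le_Rintegral => // w _; apply: le_trans (expR_le_quadratic _) _.
    by rewrite (le_trans (ler_norm _))// (le_trans (Yb w)).
  have : Y w ^+ 2 <= b ^+ 2 by rewrite -real_normK ?num_real// lerXn2r ?nnegrE.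
  lra.
rewrite RintegralD//; last exact: finite_measure_integrable_cst.
by rewrite Y0 addr0 Rintegral_cst1 expR_ge1Dx.
Qed.

(** Markov's inequality for the exponential of the sum. The usual free parameter is left to callers,
    who scale the [Y j]. *)
Lemma chernoff {J : eqType} (Y : J -> Omega -> R) (r : seq J) (b a : R) :
  (forall j, measurable_fun setT (Y j)) -> uniq r -> indep P Y r ->
  (forall j w, `|Y j w| <= b) -> b <= 2^-1 ->
  (forall j, j \in r -> \int[P]_w Y j w = 0) ->
  (P [set w | (a <= \sum_(j <- r) Y j w)%R] <= (expR ((size r)%:R * (2 * b ^+ 2) - a))%:E)%E.
Proof.
move=> mY ur iY Yb b2 Y0; set S := fun w => \sum_(j <- r) Y j w.
have mS : measurable_fun setT S by exact: measurable_sum.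
have mA : measurable [set w | a <= S w] by exact: measurable_set_ge.
rewrite -[X in P X]setIT -integral_indic//.
apply: (@le_trans _ _ (\int[P]_w ((expR (- a))%:E * (expR (S w))%:E)))%E.
  apply: ge0_le_integral => //.
  - by apply/measurable_EFinP; exact: measurable_indic.
  - apply: measurable_funeM; apply/measurable_EFinP; exact: measurableT_comp.
  - move=> w _; rewrite -EFinM lee_fin -expRD indicE; have [h|h] := leP a (S w).
      by rewrite mem_set//= -[leLHS]expR0 ler_expR addrC subr_ge0.
    by rewrite memNset ?expR_ge0//=; apply/negP; rewrite -ltNge.
rewrite ge0_integralZl//; last by apply/measurable_EFinP; exact: measurableT_comp.
rewrite integral_expR_sum_indep// addrC expRD EFinM.
apply: lee_pmul => //; rewrite ?lee_fin ?expR_ge0//.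
  by apply: prode_ge0 => j _; apply: integral_ge0 => w _; rewrite lee_fin expR_ge0.
rewrite expRM_natl.
elim: (r) {-}Y0 => [|j s IH] Y0'; first by rewrite big_nil.
rewrite big_cons /= exprS EFinM; apply: lee_pmul.
- by apply: integral_ge0 => w _; rewrite lee_fin expR_ge0.
- by apply: prode_ge0 => i _; apply: integral_ge0 => w _; rewrite lee_fin expR_ge0.
- by apply: integral_expR_le => //; apply: Y0'; rewrite mem_head.
- by apply: IH => i js; apply: Y0'; rewrite inE js orbT.
Qed.

Lemma chernoff_abs {J : eqType} (Y : J -> Omega -> R) (r : seq J) (b a : R) :
  (forall j, measurable_fun setT (Y j)) -> uniq r -> indep P Y r ->
  (forall j w, `|Y j w| <= b) -> b <= 2^-1 ->
  (forall j, j \in r -> \int[P]_w Y j w = 0) ->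
  (P [set w | (a <= `|\sum_(j <- r) Y j w|)%R] <=
    (2 * expR ((size r)%:R * (2 * b ^+ 2) - a))%:E)%E.
Proof.
move=> mY ur iY Yb b2 Y0; set S := fun w => \sum_(j <- r) Y j w.
have mS : measurable_fun setT S by exact: measurable_sum.
pose Y' j w := - Y j w.
have mY' j : measurable_fun setT (Y' j) by exact: measurableT_comp.
have -> : [set w | a <= `|S w|] = [set w | a <= S w] `|` [set w | a <= \sum_(j <- r) Y' j w].
  apply/seteqP; split => w /=; rewrite sumrN.
    by rewrite ler_normr => /orP[]; [left|right].
  by move=> h; rewrite ler_normr; apply/orP; case: h; [left|right].
apply: (le_trans (measureU2 _ _ _)).
- exact: measurable_set_ge.
- by apply: measurable_set_ge; exact: measurable_sum.
rewrite mulr2n mulrDl mul1r EFinD; apply: leeD; first exact: chernoff.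
apply: chernoff => //.
- exact: (indep_comp (@oppr_measurable R setT) iY).
- by move=> j w; rewrite normrN.
- move=> j jr; rewrite (_ : \int[P]_w _ = \int[P]_w (-1 * Y j w)).
    by rewrite RintegralZl ?Y0 ?mulr0//; exact: integrable_bounded (Yb j).
  by apply: eq_Rintegral => w _; rewrite mulN1r.
Qed.

End Chernoff.

(** * Concentration of V-statistics *)

Section VStatistic.
Context {R : realType}.

(** Indices [l < m] are listed by [s = l + m], so that [l < m] reads [l.*2 < s], and each entry is
    joined to its mirror image. *)
Lemma sum_square_antidiagonal (F : nat -> nat -> R) n :
  \sum_(0 <= l < n) \sum_(0 <= m < n) F l m = \sum_(0 <= l < n) F l l +
  \sum_(0 <= s < n.*2) \sum_(0 <= l < n | (l.*2 < s)%N && (s - l < n)%N)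
     (F l (s - l)%N + F (s - l)%N l).
Proof.
have upper (H : nat -> nat -> R) :
    \sum_(0 <= l < n) \sum_(0 <= m < n | (l < m)%N) H l m =
    \sum_(0 <= s < n.*2) \sum_(0 <= l < n | (l.*2 < s)%N && (s - l < n)%N) H l (s - l)%N.
  rewrite [RHS](exchange_big_dep_nat xpredT)//=; apply: eq_big_nat => l ln.
  transitivity (\sum_(0 + l <= s < n + l | (l < s - l)%N) H l (s - l)%N).
    rewrite big_addn addnK; apply: eq_big => [m|m _]; first by rewrite addnK.
    by rewrite addnK.
  rewrite [LHS](@big_nat_widen _ _ _ _ _ n.*2); last lia.
  by rewrite [LHS](@big_nat_widenl _ _ _ _ 0)//; apply: eq_bigl => s; lia.
have lower : \sum_(0 <= l < n) \sum_(0 <= m < n | (m < l)%N) F l m =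
    \sum_(0 <= l < n) \sum_(0 <= m < n | (l < m)%N) F m l.
  rewrite (exchange_big_dep_nat xpredT)//=.
transitivity (\sum_(0 <= l < n) (F l l + (\sum_(0 <= m < n | (l < m)%N) F l m +
    \sum_(0 <= m < n | (m < l)%N) F l m))).
  apply: eq_big_nat => l ln.
  rewrite (bigD1_seq l) ?mem_index_iota ?iota_uniq//=; congr (_ + _).
  rewrite (bigID (fun m => (l < m)%N))/=; congr (_ + _).
    by apply: eq_bigl => m; lia.
  by apply: eq_bigl => m; lia.
rewrite !big_split/= lower !upper; congr (_ + _).
by rewrite -big_split/=; apply: eq_bigr => s _; rewrite -big_split.
Qed.

Context {dO : measure_display} {Omega : measurableType dO}.
Variable P : probability Omega R.
Context {d : measure_display} {T : measurableType d}.
Variable Z : nat -> Omega -> T.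
Hypothesis mZ : forall l, measurable_fun setT (Z l).
Hypothesis iZ : forall s, uniq s -> indep P Z s.
Variables (h : T -> T -> R) (B mu : R).
Hypothesis mh : measurable_fun setT (fun z : T * T => h z.1 z.2).
Hypothesis B0 : 0 < B.
Hypothesis hB : forall x y, `|h x y| <= B.
Hypothesis hmu : forall l m, l != m -> \int[P]_w h (Z l w) (Z m w) = mu.

Definition vstat_sum n w := \sum_(l < n) \sum_(m < n) h (Z l w) (Z m w).

Lemma measurable_h2 l m : measurable_fun setT (fun w => h (Z l w) (Z m w)).
Proof.
apply: (@measurableT_comp _ _ _ _ _ _ (fun z : T * T => h z.1 z.2) _
  (fun w => (Z l w, Z m w))) => //.
exact: measurable_fun_pair.
Qed.

Lemma mean_le : `|mu| <= B.
Proof.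
rewrite -(@hmu 0%N 1%N)//; apply: Rintegral_norm_le => //; exact: measurable_h2.
Qed.

(** The two mirror terms, centred together: each unordered pair of indices contributes one
    variable. *)
Let phi z := h z.1 z.2 + h z.2 z.1 - 2 * mu.

Lemma measurable_phi : measurable_fun setT phi.
Proof.
apply: measurable_funB => //; apply: measurable_funD => //.
apply: (@measurableT_comp _ _ _ _ _ _ (fun z : T * T => h z.1 z.2) _
  (fun z : T * T => (z.2, z.1))) => //.
by apply: measurable_fun_pair; [exact: measurable_snd|exact: measurable_fst].
Qed.

Lemma phi_le z : `|phi z| <= 4 * B.
Proof.
have := hB z.1 z.2; have := hB z.2 z.1; have := mean_le.
rewrite /phi !ler_norml => /andP[? ?] /andP[? ?] /andP[? ?].
by apply/andP; split; lra.
Qed.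

(** [lam] is the Chernoff parameter, kept free until the deviation is known; [n] bounds the number
    of terms of an antidiagonal. *)
Lemma antidiagonal_concentration (n s : nat) (a lam : R) : 0 < lam -> lam * (4 * B) <= 2^-1 ->
  (P [set w | (a <= `|\sum_(0 <= l < n | (l.*2 < s)%N && (s - l < n)%N)
        phi (Z l w, Z (s - l)%N w)|)%R] <=
   (2 * expR (n%:R * (2 * (lam * (4 * B)) ^+ 2) - lam * a))%:E)%E.
Proof.
move=> lam0 lamB; pose r := [seq l <- index_iota 0 n | (l.*2 < s)%N && (s - l < n)%N].
have ur : uniq r by rewrite filter_uniq// iota_uniq.
have mr l : l \in r -> (l.*2 < s)%N by rewrite mem_filter => /andP[/andP[]].
have szr : (size r <= n)%N by rewrite size_filter (leq_trans (count_size _ _))// size_iota subn0.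
pose Y l w := lam * phi (Z l w, Z (s - l)%N w).
have mpair l : measurable_fun setT (fun w => (Z l w, Z (s - l)%N w)).
  exact: measurable_fun_pair.
have mphi2 l : measurable_fun setT (fun w => phi (Z l w, Z (s - l)%N w)).
  by apply: measurableT_comp; [exact: measurable_phi|].
have mY l : measurable_fun setT (Y l) by exact: measurable_funM.
have iY : indep P Y r.
  have ip : indep P (fun l w => (Z l w, Z (s - l)%N w)) r.
    apply: (@indep_pairing _ _ _ P _ _ _ _ Z id (fun l => s - l)%N) => //.
    rewrite cat_uniq map_id ur /=; apply/andP; split.
      apply/hasPn => _ /mapP[l lr ->]; apply/negP => /mr.
      by move/mr: lr; lia.
    rewrite map_inj_in_uniq// => l m /mr lr /mr mr'; lia.
  have mlphi : measurable_fun setT (fun z : T * T => lam * phi z).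
    by apply: measurable_funM => //; exact: measurable_phi.
  exact: (indep_comp mlphi ip).
have Y0 l : l \in r -> \int[P]_w Y l w = 0.
  move=> /mr ls; have nl : l != (s - l)%N by lia.
  have hi i j : P.-integrable setT (EFin \o (fun w => h (Z i w) (Z j w))).
    by apply: integrable_bounded => //; exact: measurable_h2.
  rewrite RintegralZl//; last first.
    by apply: (@integrable_bounded _ _ _ P _ (4 * B)) => // w; exact: phi_le.
  rewrite RintegralB//; last 2 first.
  - apply: (@integrable_bounded _ _ _ P _ (B + B)).
      by apply: measurable_funD; exact: measurable_h2.
    by move=> w; rewrite (le_trans (ler_normD _ _))// lerD.
  - exact: finite_measure_integrable_cst.
  rewrite RintegralD//= Rintegral_cst1 !hmu//; last by rewrite eq_sym.
  by rewrite (_ : mu + mu - 2 * mu = 0) ?mulr0//; ring.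
have Yb l w : `|Y l w| <= lam * (4 * B).
  by rewrite normrM gtr0_norm// ler_pM2l// phi_le.
apply: (@le_trans _ _ (2 * expR ((size r)%:R * (2 * (lam * (4 * B)) ^+ 2) - lam * a))%:E).
  apply: le_trans (chernoff_abs (lam * a) mY ur iY Yb lamB Y0).
  rewrite (_ : [set w | _] = [set w | lam * a <= `|\sum_(j <- r) Y j w|])//.
  apply/seteqP; split=> w /=; rewrite -mulr_sumr normrM (gtr0_norm lam0) ler_pM2l//;
    by rewrite big_filter.
rewrite lee_fin ler_pM2l// ler_expR lerB// ler_wpM2r ?ler_nat//.
by rewrite mulr_ge0// sqr_ge0.
Qed.

(* The off-diagonal pairs split into the antidiagonals [l + m = s], each of which
   involves pairwise disjoint index pairs, so that its terms are independent. *)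
Lemma vstat_concentration (eps : R) : 0 < eps ->
  exists A c : R, [/\ 0 < A, 0 < c & exists n0, forall n, (n0 <= n)%N ->
    (P [set w | (eps * n%:R ^+ 2 <= `|vstat_sum n w - n%:R ^+ 2 * mu|)%R] <=
     (A * expR (- c * n%:R))%:E)%E].
Proof.
move=> eps0.
have den0 : 0 < 256 * B ^+ 2 + 8 * B * eps.
  have := mulr_gt0 B0 eps0; have B20 : 0 < B ^+ 2 by exact: exprn_gt0.
  lra.
(* Two demands on [lam]: [8 * B * eps] ensures [lam * (4 * B) <= 2^-1], and [256 * B ^+ 2] keeps the
   quadratic term of the exponent below half of the linear term [lam * eps * n / 4]. *)
have [lam [lam0 lamE]] : exists lam : R, 0 < lam /\ lam * (256 * B ^+ 2 + 8 * B * eps) = eps.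
  exists (eps / (256 * B ^+ 2 + 8 * B * eps)).
  by rewrite divr_gt0// divfK// gt_eqF.
have lam1 : lam * (4 * B) <= 2^-1.
  rewrite -(ler_pM2r eps0) -{2}lamE.
  have : 0 < lam * B ^+ 2 by rewrite mulr_gt0// exprn_gt0.
  by nra.
pose c : R := lam * eps / 8.
have c0 : 0 < c by rewrite divr_gt0// mulr_gt0.
have lam2 : 32 * B ^+ 2 * lam ^+ 2 <= c.
  have -> : c = 32 * B ^+ 2 * lam ^+ 2 + B * eps * lam ^+ 2.
    by rewrite /c -[in LHS]lamE; field.
  by rewrite lerDl mulr_ge0 ?sqr_ge0// mulr_ge0// ltW.
(* Half of the rate pays for the factor [4 * n] of the union bound, by [x * expR (- x) <= 1] at
   [x = c / 2 * n]. *)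
exists (8 / c), (c / 2); split; [by rewrite divr_gt0|by rewrite divr_gt0|].
(* From here on the diagonal accounts for at most half of [eps * n ^+ 2]; the [2 * n] antidiagonals
   share the other half, [eps * n / 4] each. *)
exists (Num.truncn (4 * B / eps)).+1 => n n0.
have n_ge : 4 * B <= eps * n%:R.
  rewrite [leRHS]mulrC -ler_pdivrMr//; apply: le_trans (ltW (truncnS_gt _)) _.
  by rewrite ler_nat.
have npos : (0 < n)%N by case: (n) n0.
have nR0 : 0 < n%:R :> R by rewrite ltr0n.
pose D s := [set w | (eps * n%:R / 4 <= `|\sum_(0 <= l < n | (l.*2 < s)%N && (s - l < n)%N)
        phi (Z l w, Z (s - l)%N w)|)%R].
have mD s : measurable (D s).
  apply: measurable_set_ge; apply: measurableT_comp => //.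
  under eq_fun do rewrite -big_filter; apply: measurable_sum => l.
  by apply: measurableT_comp; [exact: measurable_phi|exact: measurable_fun_pair].
have mV : measurable [set w | eps * n%:R ^+ 2 <= `|vstat_sum n w - n%:R ^+ 2 * mu|].
  apply: measurable_set_ge; apply: measurableT_comp => //; apply: measurable_funB => //.
  by apply: measurable_sum => l; apply: measurable_sum => m; exact: measurable_h2.
apply: (@le_trans _ _ (\sum_(s < n.*2) P (D s))%E).
  apply: content_subadditive => //.
  move=> w /= hw; rewrite -bigcup_mkord; apply: contrapT => nD.
  have Dlt s : (s < n.*2)%N -> `|\sum_(0 <= l < n | (l.*2 < s)%N && (s - l < n)%N)
        phi (Z l w, Z (s - l)%N w)| < eps * n%:R / 4.
    by move=> sn; rewrite ltNge; apply/negP => h1; apply: nD; exists s.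
  pose F l m := h (Z l w) (Z m w) - mu.
  have VE : vstat_sum n w - n%:R ^+ 2 * mu = \sum_(0 <= l < n) \sum_(0 <= m < n) F l m.
    rewrite big_mkord /vstat_sum.
    under [RHS]eq_bigr do rewrite big_mkord sumrB sumr_const card_ord.
    rewrite sumrB sumr_const card_ord; congr (_ - _).
    by rewrite expr2 -mulrA !mulr_natl.
  move: hw; apply/negP; rewrite -ltNge VE sum_square_antidiagonal.
  apply: le_lt_trans (ler_normD _ _) _.
  have h1 : `|\sum_(0 <= l < n) F l l| <= n%:R * (2 * B).
    apply: le_trans (ler_norm_sum _ _ _) _; rewrite big_mkord.
    apply: (@le_trans _ _ (\sum_(l < n) (2 * B))); last first.
      by rewrite sumr_const card_ord [leRHS]mulr_natl.
    apply: ler_sum => l _; rewrite (le_trans (ler_normB _ _))// mulr_natl mulr2n lerD//.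
    exact: mean_le.
  have h2 : `|\sum_(0 <= s < n.*2) \sum_(0 <= l < n | (l.*2 < s)%N && (s - l < n)%N)
     (F l (s - l)%N + F (s - l)%N l)| < n.*2%:R * (eps * n%:R / 4).
    apply: le_lt_trans (ler_norm_sum _ _ _) _.
    rewrite big_mkord [ltRHS]mulr_natl -[X in _ *+ X](card_ord n.*2) -sumr_const.
    apply: ltr_sum => [|s _]; last first.
      rewrite (_ : \sum_(0 <= l < n | _) _ = \sum_(0 <= l < n | (l.*2 < s)%N && (s - l < n)%N)
        phi (Z l w, Z (s - l)%N w)); first exact: Dlt.
      by apply: eq_bigr => l _; rewrite /F /phi /=; ring.
    have n2 : (0 < n.*2)%N by rewrite double_gt0.
    by apply/hasP; exists (Ordinal n2) => //; exact: mem_index_enum.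
  apply: lt_le_trans (ler_ltD h1 h2) _.
  have := ler_wpM2l (ltW nR0) n_ge; rewrite -addnn natrD expr2; nra.
apply: (@le_trans _ _ (\sum_(s < n.*2) (2 * expR (- (c * n%:R)))%:E)%E).
  apply: lee_sum => s _; apply: le_trans (antidiagonal_concentration n s _ lam0 lam1) _.
  rewrite lee_fin ler_pM2l// ler_expR.
  by have := ler_wpM2l (ltW nR0) lam2; rewrite /c; lra.
rewrite sumEFin lee_fin sumr_const card_ord -[leLHS]mulr_natl -addnn natrD.
have -> : expR (- (c * n%:R)) = expR (- (c / 2) * n%:R) * expR (- (c / 2 * n%:R)).
  by rewrite -expRD; congr expR; field.
have e1 : c / 2 * n%:R * expR (- (c / 2 * n%:R)) <= 1.
  rewrite expRN ler_pdivrMr ?expR_gt0// mul1r.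
  by apply: le_trans (expR_ge1Dx _); rewrite lerDr.
have e2 := expR_gt0 (- (c / 2) * n%:R).
rewrite [leLHS](_ : _ = 8 / c * expR (- (c / 2) * n%:R) * (c / 2 * n%:R * expR (- (c / 2 * n%:R)))).
  apply: ler_piMr => //; apply: mulr_ge0; last exact: ltW.
  by apply: divr_ge0 => //; exact: ltW.
by field; rewrite gt_eqF.
Qed.

End VStatistic.

(** * Reproducing kernels *)

Section KernelForm.
Context {R : realType} {T : Type}.
Variable k : T -> T -> R.
Hypothesis kpd : pos_def_kernel k.
Implicit Types (s t : seq (R * T)) (f : T -> R).

(** A list of weighted points stands for a finite combination of kernel sections: [qform] is the
    RKHS inner product of two of them, [lform f] the pairing with [f]. On lists, addition is
    concatenation. *)
Definition qform s t := \sum_(a <- s) \sum_(b <- t) a.1 * b.1 * k a.2 b.2.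
Definition lform f s := \sum_(a <- s) a.1 * f a.2.
Definition wscale (c : R) s := [seq (c * a.1, a.2) | a <- s].

Lemma qformC s t : qform s t = qform t s.
Proof.
rewrite /qform exchange_big/=; apply: eq_bigr => b _; apply: eq_bigr => a _.
by rewrite [a.1 * _]mulrC; congr (_ * _); case: kpd.
Qed.

Lemma qformDl s1 s2 t : qform (s1 ++ s2) t = qform s1 t + qform s2 t.
Proof. by rewrite /qform big_cat. Qed.

Lemma qformZl c s t : qform (wscale c s) t = c * qform s t.
Proof.
rewrite /qform big_map mulr_sumr; apply: eq_bigr => a _.
by rewrite mulr_sumr; apply: eq_bigr => b _ /=; rewrite !mulrA.
Qed.

Lemma qform_sqrD s t : qform (s ++ t) (s ++ t) = qform s s + 2 * qform s t + qform t t.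
Proof.
rewrite qformDl ![qform _ (s ++ t)]qformC !qformDl [qform t s]qformC; ring.
Qed.

Lemma qform_sqrZ c s : qform (wscale c s) (wscale c s) = c ^+ 2 * qform s s.
Proof. by rewrite qformZl qformC qformZl mulrA expr2. Qed.

Lemma lformD f s t : lform f (s ++ t) = lform f s + lform f t.
Proof. by rewrite /lform big_cat. Qed.

Lemma lformZ f c s : lform f (wscale c s) = c * lform f s.
Proof.
by rewrite /lform big_map mulr_sumr; apply: eq_bigr => a _ /=; rewrite mulrA.
Qed.

Lemma qform_ge0 s : 0 <= qform s s.
Proof.
have [_ kp] := kpd.
have := kp (size s) (fun i => (tnth (in_tuple s) i).2) (fun i => (tnth (in_tuple s) i).1).
rewrite /qform [in X in _ -> X]big_tnth.
by under [in X in _ -> X]eq_bigr do rewrite big_tnth.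
Qed.

Lemma rkhs_unit_ballP f : rkhs_unit_ball k f <-> forall s, lform f s ^+ 2 <= qform s s.
Proof.
split=> [bf s|bf n x c].
  have := bf (size s) (fun i => (tnth (in_tuple s) i).2) (fun i => (tnth (in_tuple s) i).1).
  rewrite /qform /lform [in X in _ -> X]big_tnth [in X in _ -> _ <= X]big_tnth.
  by under [in X in _ -> _ <= X]eq_bigr do rewrite big_tnth.
have := bf [seq (c i, x i) | i <- index_enum 'I_n].
rewrite /lform /qform !big_map/= => h; apply: le_trans h _.
rewrite le_eqVlt; apply/orP; left; apply/eqP.
by apply: eq_bigr => i _; rewrite big_map.
Qed.

Lemma discriminant_le (a b c : R) : 0 <= c ->
  (forall x, 0 <= a + 2 * (x * b) + x ^+ 2 * c) -> b ^+ 2 <= a * c.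
Proof.
move=> c0 h; have [ce0|cn0] := eqVneq c 0.
  have [->|bn0] := eqVneq b 0; first by rewrite expr0n/= ce0 mulr0.
  (* At this point the affine function takes the value -1. *)
  have := h (- (a + 1) / (2 * b)); rewrite ce0 mulr0 addr0 => {}h.
  suff : 0 <= -1 :> R by rewrite ler0N1.
  rewrite [leRHS](_ : _ = a + 2 * (- (a + 1) / (2 * b) * b))//.
  by field.
have cp : 0 < c by rewrite lt_def cn0.
have := h (- b / c); rewrite -(pmulr_lge0 _ cp).
have -> : (a + 2 * (- b / c * b) + (- b / c) ^+ 2 * c) * c = a * c - b ^+ 2 by field.
by rewrite subr_ge0.
Qed.

Lemma qform_CS s t : qform s t ^+ 2 <= qform s s * qform t t.
Proof.
apply: discriminant_le => [|x]; first exact: qform_ge0.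
by rewrite -qform_sqrZ -[x * _]mulrC [qform s t]qformC mulrC -qformZl qformC -qform_sqrD qform_ge0.
Qed.

End KernelForm.

Lemma cvg_of_harmonic_bound {R : realType} (u : R^nat) (l c : R) :
  (forall m, `|l - u m| <= c * m.+1%:R^-1) -> u @ \oo --> l.
Proof.
move=> ub; apply/cvgrPdist_le => e e0.
have /cvgrPdist_le/(_ e e0) : (fun m => c * m.+1%:R^-1 : R) @ \oo --> (0 : R).
  by rewrite -(mulr0 c); apply: cvgM; [exact: cvg_cst|exact: cvg_harmonic].
apply: filterS => m; rewrite sub0r normrN => h.
by rewrite (le_trans (ub m))// (le_trans (ler_norm _)).
Qed.

Lemma le_of_harmonic_bound {R : realType} (x y c : R) :
  (forall n, x <= y + c * n.+1%:R^-1) -> x <= y.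
Proof.
move=> h; rewrite leNgt; apply/negP => yx.
pose n := Num.truncn (c / (x - y)).
have xy : 0 < x - y by rewrite subr_gt0.
have : c / (x - y) < n.+1%:R by exact: truncnS_gt.
rewrite ltr_pdivrMr// => h1; have := h n.
have n0 : 0 < n.+1%:R :> R by rewrite ltr0n.
by rewrite -lerBlDl ler_pdivlMr//; lra.
Qed.

Section BallMeasurable.
Context {R : realType} {d : measure_display} {T : measurableType d}.
Variables (k : T -> T -> R) (G : R).
Hypothesis kmeas : measurable_fun setT (fun z : T * T => k z.1 z.2).
Hypothesis kpd : pos_def_kernel k.
Hypothesis kb : forall x y, 0 <= k x y <= G.

Lemma measurable_ksection y : measurable_fun setT (k y).
Proof.
apply: (@measurableT_comp _ _ _ _ _ _ (fun z : T * T => k z.1 z.2) _ (fun x => (y, x))) => //.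
exact: measurable_fun_pair.
Qed.

(* A maximizing sequence for the norm of [f] converges to the Riesz representative
   of [f], so that [f] is a pointwise limit of finite combinations of kernel sections. *)
Lemma rkhs_unit_ball_measurable f : rkhs_unit_ball k f -> measurable_fun setT f.
Proof.
move=> /rkhs_unit_ballP bf.
(* [sup V] is the RKHS norm of [f], computed by duality on combinations of norm at most 1. *)
pose V := [set v | exists2 s, qform k s s <= 1 & v = lform f s].
have V0 : V !=set0.
  exists 0, [::]; rewrite /qform /lform ?big_nil//.
have V1 : has_ubound V.
  exists 1 => _ [s s1 ->]; have := le_trans (bf s) s1; have [//|lt1] := leP (lform f s) 1.
  by nra.
have Vsup : has_sup V by [].
pose sg := sup V.
have sg0 : 0 <= sg by apply: (ub_le_sup V1); exists [::]; rewrite /qform /lform ?big_nil.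
(* By homogeneity. A combination of norm 0 cannot be rescaled; there the ball inequality forces
   [lform f s = 0]. *)
have hom1 s : lform f s <= sg * Num.sqrt (qform k s s).
  have q0 := qform_ge0 kpd s.
  have [q00|qn0] := eqVneq (qform k s s) 0.
    rewrite q00 sqrtr0 mulr0; have := bf s; rewrite q00; nra.
  have rp : 0 < Num.sqrt (qform k s s) by rewrite sqrtr_gt0 lt_def qn0.
  rewrite -ler_pdivrMr// mulrC -lformZ; apply: (ub_le_sup V1).
  exists (wscale (Num.sqrt (qform k s s))^-1 s) => //.
  by rewrite qform_sqrZ// exprVn sqr_sqrtr// mulVf.
have hom s : lform f s ^+ 2 <= sg ^+ 2 * qform k s s.
  have q0 := qform_ge0 kpd s.
  have h1 := hom1 s; have := hom1 (wscale (-1) s).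
  rewrite lformZ qform_sqrZ// sqrrN expr1n mul1r mulN1r => h2.
  rewrite -[X in _ * X](sqr_sqrtr q0) -exprMn -[leLHS]real_normK ?num_real//.
  rewrite lerXn2r ?nnegrE ?mulr_ge0 ?sqrtr_ge0// ler_norml h1 andbT; lra.
have [sg00|sgn0] := eqVneq sg 0.
  rewrite (_ : f = cst 0); first exact: measurable_cst.
  apply/funext => x; have := hom [:: (1, x)].
  rewrite sg00 expr0n mul0r /lform big_seq1 mul1r => h.
  by apply/eqP; rewrite -sqrf_eq0 eq_le h sqr_ge0.
have sgp : 0 < sg by rewrite lt_def sgn0.
(* The deficit is a square because the final error is of the order of its square root. *)
have seqs m : exists s, qform k s s <= 1 /\ sg - m.+1%:R^-1 ^+ 2 < lform f s.
  have e0 : 0 < m.+1%:R^-1 ^+ 2 :> R by rewrite exprn_gt0// invr_gt0 ltr0n.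
  by have [_ [s s1 ->] h] := sup_adherent e0 Vsup; exists s.
have [c cP] := choice seqs.
pose g m x := qform k (c m) [:: (1, x)].
apply: (@measurable_fun_cvg _ _ _ setT (fun m x => sg * g m x)).
  move=> m; apply: measurable_funM => //.
  rewrite /g /qform; apply: measurable_sum => a.
  rewrite (_ : (fun x => _) = (fun x => a.1 * k a.2 x)); last first.
    by apply/funext => x; rewrite big_seq1 mulr1.
  by apply: measurable_funM => //; exact: measurable_ksection.
move=> x _; apply: (@cvg_of_harmonic_bound _ _ _ ((1 + G / 2 + `|f x|) / sg)) => m.
have [q1 L1] := cP m; set L := lform f (c m) in L1.
have Lsg : L <= sg by apply: (ub_le_sup V1); exists (c m).
set tau : R := m.+1%:R^-1 in L1 *.
have tau0 : 0 < tau by rewrite invr_gt0 ltr0n.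
(* This is [hom] at the near-maximizer perturbed by [t] times the point [x]; the first-order terms
   in [t] compare [f x] with [sg * g m x]. *)
have key t : 2 * t * (L * f x - sg ^+ 2 * g m x) <= 2 * sg * tau ^+ 2 + t ^+ 2 * (sg ^+ 2 * G).
  have := hom (c m ++ wscale t [:: (1, x)]).
  rewrite lformD lformZ qform_sqrD// qform_sqrZ// [qform k (c m) (wscale _ _)]qformC// qformZl.
  rewrite [qform k [:: (1, x)] (c m)]qformC// -/(g m x) -/L.
  have -> : lform f [:: (1, x)] = f x by rewrite /lform big_seq1 mul1r.
  have -> : qform k [:: (1, x)] [:: (1, x)] = k x x by rewrite /qform !big_seq1 !mul1r.
  move=> h.
  have a1 : sg ^+ 2 * qform k (c m) (c m) <= sg ^+ 2 by rewrite ler_piMr// sqr_ge0.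
  have /andP[_ kG] := kb x x.
  have a2 : sg ^+ 2 * (t ^+ 2 * k x x) <= sg ^+ 2 * (t ^+ 2 * G).
    by rewrite ler_wpM2l ?sqr_ge0// ler_wpM2l ?sqr_ge0.
  have a3 : sg ^+ 2 - L ^+ 2 <= 2 * sg * tau ^+ 2.
    have : 0 <= (sg - L) ^+ 2 by exact: sqr_ge0.
    have : sg * (sg - L) <= sg * tau ^+ 2 by rewrite ler_wpM2l//; lra.
    lra.
  have a4 : 0 <= (t * f x) ^+ 2 by exact: sqr_ge0.
  lra.
have sg1 : sg <= 1.
  apply: ge_sup => // _ [s s1 ->].
  by have := le_trans (bf s) s1; have [//|lt1] := leP (lform f s) 1; nra.
have G0 : 0 <= G by have /andP[/le_trans h /h] := kb x x.
have bd : `|L * f x - sg ^+ 2 * g m x| <= tau * (1 + G / 2).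
  have s2 : sg ^+ 2 * G <= G by rewrite ler_piMl// expr_le1.
  have s3 : tau ^+ 2 * (sg ^+ 2 * G) <= tau ^+ 2 * G by rewrite ler_wpM2l// sqr_ge0.
  have s4 : 2 * sg * tau ^+ 2 <= 2 * tau ^+ 2 by rewrite ler_wpM2r ?sqr_ge0//; lra.
  (* With [t] of size [tau] both error terms are of order [tau ^+ 2]; the two signs give the
     absolute value. *)
  have := key tau; have := key (- tau); rewrite sqrrN => k1 k2.
  rewrite ler_norml; apply/andP; split; rewrite -(ler_pM2l tau0); nra.
have bd2 : `|sg * f x - L * f x| <= tau * `|f x|.
  rewrite -mulrBl normrM ler_wpM2r// ger0_norm ?subr_ge0//.
  apply: (@le_trans _ _ (tau ^+ 2)); first lra.
  by rewrite expr2 ler_piMr ?(ltW tau0)// invf_le1 ?ltr0n// ler1n.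
rewrite -(ler_pM2l sgp) mulrA [sg * (_ / sg)]mulrC divfK//.
rewrite -{1}(gtr0_norm sgp) -normrM mulrBr mulrA -expr2.
rewrite (_ : _ - _ = (sg * f x - L * f x) + (L * f x - sg ^+ 2 * g m x)); last by ring.
rewrite (le_trans (ler_normD _ _))//; nra.
Qed.

End BallMeasurable.

(** * The maximum mean discrepancy and its estimate *)

Section MMD.
Context {R : realType} {dO dT : measure_display}.
Context {Omega : measurableType dO} {T : measurableType dT}.
Variables (P : probability Omega R) (M : nat) (p : 'I_M -> probability T R).
Variable X : 'I_M -> nat -> Omega -> T.
Hypothesis mX : forall i l, measurable_fun setT (X i l).
Hypothesis lawX : forall i l (B : set T), measurable B -> P (X i l @^-1` B) = p i B.
Hypothesis iX : forall s, uniq s -> indep P (fun il : 'I_M * nat => X il.1 il.2) s.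
Variables (k : T -> T -> R) (G : R).
Hypothesis kmeas : measurable_fun setT (fun z : T * T => k z.1 z.2).
Hypothesis kpd : pos_def_kernel k.
Hypothesis kb : forall x y, 0 <= k x y <= G.

Lemma kbound_ge0 : 0 <= G.
Proof. by have /andP[/le_trans h /h] := kb point point. Qed.

Lemma norm_k x y : `|k x y| <= G.
Proof. by have /andP[k0 kG] := kb x y; rewrite ger0_norm. Qed.

Lemma measurable_kXX i l j m : measurable_fun setT (fun w => k (X i l w) (X j m w)).
Proof.
apply: (@measurableT_comp _ _ _ _ _ _ (fun z : T * T => k z.1 z.2) _
  (fun w => (X i l w, X j m w))) => //.
exact: measurable_fun_pair.
Qed.

(** The mean embedding of [p i], as a function; [kmean2] gives the inner products of these
    embeddings. *)
Definition kmean i x := \int[p i]_y k x y.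
Definition kmean2 i j := \int[p i]_x kmean j x.

Lemma kmeanE i x : (\int[p i]_y (k x y)%:E)%E = (kmean i x)%:E.
Proof.
apply: EFin_Rintegral; apply: (@integrable_bounded _ _ _ _ _ G).
  exact: measurable_ksection kmeas x.
by move=> y; exact: norm_k.
Qed.

Lemma measurable_kmean i : measurable_fun setT (kmean i).
Proof.
apply/measurable_EFinP.
rewrite (_ : EFin \o _ = fubini_F (p i) (fun z : T * T => (k z.1 z.2)%:E)); last first.
  by apply/funext => x; rewrite /fubini_F/= kmeanE.
apply: measurable_fun_fubini_tonelli_F; first exact/measurable_EFinP.
by move=> z; rewrite lee_fin; have /andP[] := kb z.1 z.2.
Qed.

Lemma norm_kmean i x : `|kmean i x| <= G.
Proof.
apply: Rintegral_norm_le; first exact: measurable_ksection kmeas x.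
by move=> y; exact: norm_k.
Qed.

Lemma Rintegral_X (f : T -> R) (B : R) i l : measurable_fun setT f ->
  (forall x, `|f x| <= B) -> \int[P]_w f (X i l w) = \int[p i]_x f x.
Proof.
move=> mf fB; rewrite /Rintegral; congr fine.
rewrite [RHS](@eq_measure_integral _ _ _ setT (pushforward P (X i l))); last first.
  by move=> A mA _; rewrite /pushforward; exact/esym/lawX.
rewrite integral_pushforward//; first exact/measurable_EFinP.
rewrite preimage_setT; apply: (@integrable_bounded _ _ _ P _ B) => //.
exact: measurableT_comp.
Qed.

(** Two distinct samples, of the same sequence or not, have a product law, to which Tonelli's
    theorem applies. *)
Lemma kXX_mean i l j m : (i, l) != (j, m) ->
  \int[P]_w k (X i l w) (X j m w) = kmean2 i j.
Proof.
move=> ilm; rewrite /kmean2 /Rintegral; congr fine.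
have mXX : measurable_fun setT (fun w => (X i l w, X j m w)) by exact: measurable_fun_pair.
have law2 S : measurable S ->
    (p i \x p j)%E S = P ((fun w => (X i l w, X j m w)) @^-1` S).
  move=> mS; have := @pair_law _ _ _ P _ _ _ _ (X i l) (X j m) (mX i l) (mX j m)
    (p i) (p j) setT measurableT.
  rewrite probability_setT => /(_ _ S mS); rewrite setTI mul1e => -> // A C mA mC.
  rewrite setTI mul1e.
  have us : uniq [:: (i, l); (j, m)] by rewrite /= inE ilm.
  have := iX us (B := fun q => if q == (i, l) then A else C).
  rewrite !big_cons !big_nil/= eqxx eq_sym (negbTE ilm) setIT mule1 !lawX//; apply.
  by move=> q; case: ifP.
rewrite (@ge0_integral_law _ _ _ P _ _ (fun w => (X i l w, X j m w)) (p i \x p j)%E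
  (fun z => k z.1 z.2)) //; last by move=> z; have /andP[] := kb z.1 z.2.
rewrite fubini_tonelli1; last 2 first.
- exact/measurable_EFinP.
- by move=> z; rewrite lee_fin; have /andP[] := kb z.1 z.2.
by apply: eq_integral => x _; rewrite /fubini_F/= kmeanE.
Qed.

(** Both sides are means over the same pair of samples; the distinct times 0 and 1 cover the case
    [i = j]. *)
Lemma kmean2C i j : kmean2 i j = kmean2 j i.
Proof.
rewrite -(@kXX_mean i 0%N j 1%N) ?xpair_eqE ?andbF// -(@kXX_mean j 1%N i 0%N) ?xpair_eqE ?andbF//.
by apply: eq_Rintegral => w _; case: kpd.
Qed.

Section Pair.
Variables i j : 'I_M.

(** The inner product of the feature differences [k z.1 - k z.2] and [k z'.1 - k z'.2]. The [2 * k]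
    of [dhat] is spread over the two cross terms, which leaves the double sum unchanged. *)
Definition hker (z z' : T * T) := k z.1 z'.1 + k z.2 z'.2 - k z.1 z'.2 - k z'.1 z.2.
Definition Zpair l w := (X i l w, X j l w).
Definition mmd2 := kmean2 i i + kmean2 j j - 2 * kmean2 i j.

Lemma measurable_Zpair l : measurable_fun setT (Zpair l).
Proof. exact: measurable_fun_pair. Qed.

Lemma measurable_hker : measurable_fun setT (fun z : (T * T) * (T * T) => hker z.1 z.2).
Proof.
have mk (f g : (T * T) * (T * T) -> T) : measurable_fun setT f -> measurable_fun setT g ->
    measurable_fun setT (fun z => k (f z) (g z)).
  move=> mf mg; apply: (@measurableT_comp _ _ _ _ _ _ (fun z : T * T => k z.1 z.2) _
    (fun z => (f z, g z))) => //.
  exact: measurable_fun_pair.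
have m1 : measurable_fun setT (fun z : (T * T) * (T * T) => z.1.1).
  by apply: (measurableT_comp measurable_fst); exact: measurable_fst.
have m2 : measurable_fun setT (fun z : (T * T) * (T * T) => z.1.2).
  by apply: (measurableT_comp measurable_snd); exact: measurable_fst.
have m3 : measurable_fun setT (fun z : (T * T) * (T * T) => z.2.1).
  by apply: (measurableT_comp measurable_fst); exact: measurable_snd.
have m4 : measurable_fun setT (fun z : (T * T) * (T * T) => z.2.2).
  by apply: (measurableT_comp measurable_snd); exact: measurable_snd.
apply: measurable_funB; last exact: mk.
apply: measurable_funB; last exact: mk.
by apply: measurable_funD; exact: mk.
Qed.

(** The [+ 1] keeps the bound positive when [G = 0], as the concentration bound demands. *)
Lemma norm_hker z z' : `|hker z z'| <= 2 * G + 1.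
Proof.
have /andP[? ?] := kb z.1 z'.1; have /andP[? ?] := kb z.2 z'.2.
have /andP[? ?] := kb z.1 z'.2; have /andP[? ?] := kb z'.1 z.2.
by rewrite ler_norml /hker; apply/andP; split; lra.
Qed.

Lemma hker_mean l m : l != m -> \int[P]_w hker (Zpair l w) (Zpair m w) = mmd2.
Proof.
move=> lm; have ki a l1 b l2 : P.-integrable setT (EFin \o (fun w => k (X a l1 w) (X b l2 w))).
  by apply: (@integrable_bounded _ _ _ P _ G) => [|w]; [exact: measurable_kXX|exact: norm_k].
have kDi : P.-integrable setT
    (EFin \o (fun w => k (X i l w) (X i m w) + k (X j l w) (X j m w))).
  exact: (integrableD measurableT (ki i l i m) (ki j l j m)).
have kBi : P.-integrable setT
    (EFin \o (fun w => k (X i l w) (X i m w) + k (X j l w) (X j m w) - k (X i l w) (X j m w))).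
  exact: (integrableB measurableT kDi (ki i l j m)).
rewrite /hker/= RintegralB// RintegralB// RintegralD// !kXX_mean; last first.
- by rewrite xpair_eqE (negbTE lm) andbF.
- by rewrite xpair_eqE (negbTE lm) andbF.
- by rewrite xpair_eqE (negbTE lm) andbF.
- by rewrite xpair_eqE (eq_sym m) (negbTE lm) andbF.
by rewrite /mmd2; ring.
Qed.

Local Notation vstat := (vstat_sum Zpair hker).

(** This is [n] times the difference of the two empirical measures. *)
Definition sample n w : seq (R * T) :=
  [seq (1, X i l w) | l <- index_iota 0 n] ++ [seq (-1, X j l w) | l <- index_iota 0 n].

(** Brings the statistic within reach of the ball inequality and of Cauchy-Schwarz, and makes it
    nonnegative. *)
Lemma vstat_qform n w : vstat n w = qform k (sample n w) (sample n w).
Proof.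
rewrite /sample qform_sqrD// /qform !big_map !big_mkord mulr_sumr -!big_split/=.
have -> : vstat n w = \sum_(l < n) \sum_(m < n)
    (k (X i l w) (X i m w) + k (X j l w) (X j m w) - 2 * k (X i l w) (X j m w)).
  rewrite /vstat_sum /hker/=.
  transitivity (\sum_(l < n) \sum_(m < n) (k (X i l w) (X i m w) + k (X j l w) (X j m w)
      - k (X i l w) (X j m w)) - \sum_(l < n) \sum_(m < n) k (X i m w) (X j l w)).
    by rewrite -sumrB; apply: eq_bigr => l _; rewrite -sumrB.
  rewrite [X in _ - X]exchange_big/= -sumrB; apply: eq_bigr => l _.
  by rewrite -sumrB; apply: eq_bigr => m _; ring.
apply: eq_bigr => l _; rewrite !big_map !big_mkord mulr_sumr -!big_split/=.
by apply: eq_bigr => m _; ring.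
Qed.

Lemma vstat_ge0 n w : 0 <= vstat n w.
Proof. by rewrite vstat_qform; exact: qform_ge0. Qed.

Lemma dhatE n w : dhat k X i j n w = Num.sqrt ((n%:R ^+ 2)^-1 * vstat n w).
Proof.
rewrite /dhat; congr (Num.sqrt (_ * _)).
rewrite /vstat_sum /hker/=.
transitivity (\sum_(l < n) \sum_(m < n) (k (X i l w) (X i m w) + k (X j l w) (X j m w)
    - k (X i l w) (X j m w)) - \sum_(l < n) \sum_(m < n) k (X i m w) (X j l w)).
  rewrite [X in _ - X]exchange_big/= -sumrB; apply: eq_bigr => l _.
  by rewrite -sumrB; apply: eq_bigr => m _; ring.
by rewrite -sumrB; apply: eq_bigr => l _; rewrite -sumrB.
Qed.

Lemma measurable_hZ l m : measurable_fun setT (fun w => hker (Zpair l w) (Zpair m w)).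
Proof. exact: (measurable_h2 measurable_Zpair measurable_hker). Qed.

Lemma measurable_vstat n : measurable_fun setT (vstat n).
Proof.
by apply: measurable_sum => l; apply: measurable_sum => m; exact: measurable_hZ.
Qed.

(** Off-diagonal terms have mean [mmd2]; each of the [n] diagonal terms is off by at most twice the
    bound of [hker]. *)
Lemma vstat_mean_le n :
  \int[P]_w vstat n w <= n%:R ^+ 2 * mmd2 + n%:R * (2 * (2 * G + 1)).
Proof.
have hi l m : P.-integrable setT (EFin \o (fun w => hker (Zpair l w) (Zpair m w))).
  apply: (@integrable_bounded _ _ _ P _ (2 * G + 1)); first exact: measurable_hZ.
  by move=> w; exact: norm_hker.
have si l : P.-integrable setT (EFin \o (fun w => \sum_(m < n) hker (Zpair l w) (Zpair m w))).
  apply: (@integrable_bounded _ _ _ P _ (\sum_(m < n) (2 * G + 1))).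
    by apply: measurable_sum => m; exact: measurable_hZ.
  move=> w; apply: le_trans (ler_norm_sum _ _ _) _; apply: ler_sum => m _; exact: norm_hker.
rewrite /vstat_sum Rintegral_sum_seq//.
apply: (@le_trans _ _ (\sum_(l < n) (n%:R * mmd2 + 2 * (2 * G + 1)))); last first.
  by rewrite sumr_const card_ord -[leLHS]mulr_natl mulrDr mulrA expr2.
apply: ler_sum => l _; rewrite Rintegral_sum_seq//.
rewrite (bigD1 l)//=.
have nm : `|mmd2| <= 2 * G + 1.
  rewrite -(@hker_mean 0%N 1%N)//; apply: Rintegral_norm_le; first exact: measurable_hZ.
  by move=> w; exact: norm_hker.
have -> : n%:R * mmd2 = mmd2 + \sum_(m < n | m != l) mmd2.
  transitivity (\sum_(m < n) mmd2); last by rewrite (bigD1 l).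
  by rewrite sumr_const card_ord mulr_natl.
rewrite [leRHS]addrAC lerD//; last first.
  by apply: ler_sum => m ml; rewrite hker_mean// eq_sym.
have : `|\int[P]_w hker (Zpair l w) (Zpair l w)| <= 2 * G + 1.
  apply: Rintegral_norm_le; first exact: measurable_hZ.
  by move=> w; exact: norm_hker.
move: nm; rewrite !ler_norml => /andP[? ?] /andP[? ?]; lra.
Qed.

(* Jensen applied to [Zs n], followed by [n --> \oo] in [vstat_mean_le]. *)
Lemma mean_sqr_le_mmd2 (Zs : nat -> Omega -> R) (B z c : R) : 0 <= c ->
  (forall n, measurable_fun setT (Zs n)) -> (forall n w, `|Zs n w| <= B) ->
  (forall n w, Zs n w ^+ 2 <= c * ((n.+1%:R ^+ 2)^-1 * vstat n.+1 w)) ->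
  (forall n, \int[P]_w Zs n w = z) -> z ^+ 2 <= c * mmd2.
Proof.
move=> c0 mZs ZsB ZsV Zsz.
apply: (@le_of_harmonic_bound _ _ _ (c * (2 * (2 * G + 1)))) => n.
have n0 : 0 < n.+1%:R :> R by rewrite ltr0n.
rewrite -(Zsz n); apply: le_trans (sqr_Rintegral_le P (mZs n) (ZsB n)) _.
have Vi : P.-integrable setT (EFin \o vstat n.+1).
  apply: (@integrable_bounded _ _ _ P _ (\sum_(l < n.+1) \sum_(m < n.+1) (2 * G + 1))).
    exact: measurable_vstat.
  move=> w; apply: le_trans (ler_norm_sum _ _ _) _; apply: ler_sum => l _.
  by apply: le_trans (ler_norm_sum _ _ _) _; apply: ler_sum => m _; exact: norm_hker.
apply: (@le_trans _ _ (\int[P]_w (c * (n.+1%:R ^+ 2)^-1 * vstat n.+1 w))).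
  apply: le_Rintegral => //.
  - apply: (@integrable_bounded _ _ _ P _ (B ^+ 2)); first exact: measurable_funX.
    by move=> w; rewrite normrX lerXn2r ?nnegrE// (le_trans _ (ZsB n w)).
  - apply: (@integrable_bounded _ _ _ P _ (`|c * (n.+1%:R ^+ 2)^-1| *
        (\sum_(l < n.+1) \sum_(m < n.+1) (2 * G + 1)))).
      by apply: measurable_funM => //; exact: measurable_vstat.
    move=> w; rewrite normrM ler_wpM2l//.
    apply: le_trans (ler_norm_sum _ _ _) _; apply: ler_sum => l _.
    by apply: le_trans (ler_norm_sum _ _ _) _; apply: ler_sum => m _; exact: norm_hker.
  - by move=> w _; rewrite -mulrA.
rewrite RintegralZl//.
apply: le_trans (ler_wpM2l _ (vstat_mean_le n.+1)) _.
  by rewrite mulr_ge0// invr_ge0 sqr_ge0.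
rewrite le_eqVlt; apply/orP; left; apply/eqP; field.
by rewrite addrC natr1 gt_eqF.
Qed.

Lemma mmd2_ge0 : 0 <= mmd2.
Proof.
have := @mean_sqr_le_mmd2 (fun _ _ => 0) 0 0 1; rewrite expr0n mul1r; apply => //.
- by move=> n w; rewrite normr0.
- by move=> n w; rewrite /= mul1r mulr_ge0 ?vstat_ge0// invr_ge0 sqr_ge0.
- by move=> n; exact: Rintegral_cst1.
Qed.

(** At a single point the ball inequality gives [f x ^+ 2 <= k x x]; [G + 1] is a convenient bound
    of the square root of [G]. *)
Lemma norm_rkhs_unit_ball f x : rkhs_unit_ball k f -> `|f x| <= G + 1.
Proof.
move=> /(rkhs_unit_ballP k) /(_ [:: (1, x)]).
rewrite /lform /qform !big_seq1/= !mul1r => h.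
have /andP[_ kG] := kb x x; have G0 := kbound_ge0.
rewrite -(@ler_pXn2r _ 2%N) ?nnegrE//; last by rewrite addr_ge0.
rewrite real_normK ?num_real//; apply: le_trans h _; nra.
Qed.

(** [Zs] is the difference of the two sample means of [f]: its mean is exact for every sample size,
    and its square is bounded by the ball inequality at [sample]. *)
Lemma witness_diff_le f : rkhs_unit_ball k f ->
  \int[p i]_x f x - \int[p j]_x f x <= Num.sqrt mmd2.
Proof.
move=> bf; have mf := rkhs_unit_ball_measurable kmeas kpd kb bf.
have fB x := norm_rkhs_unit_ball x bf.
have mfX a l : measurable_fun setT (fun w => f (X a l w)) by exact: measurableT_comp.
pose Zs n w := n.+1%:R^-1 * lform f (sample n.+1 w).
have ZsE n w : Zs n w = n.+1%:R^-1 * \sum_(l < n.+1) (f (X i l w) - f (X j l w)).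
  rewrite /Zs /lform /sample big_cat !big_map !big_mkord/= -big_split/=.
  by congr (_ * _); apply: eq_bigr => l _; rewrite mul1r mulN1r.
have n0 n : 0 < n.+1%:R :> R by rewrite ltr0n.
suff : (\int[p i]_x f x - \int[p j]_x f x) ^+ 2 <= 1 * mmd2.
  rewrite mul1r => h; rewrite (le_trans (ler_norm _))// -sqrtr_sqr ler_wsqrtr//.
have dB l w : `|f (X i l w) - f (X j l w)| <= 2 * (G + 1).
  by rewrite (le_trans (ler_normB _ _))// mulr_natl mulr2n lerD.
have mS n : measurable_fun setT (fun w => \sum_(l < n.+1) (f (X i l w) - f (X j l w))).
  by apply: measurable_sum => l; exact: measurable_funB.
have SB n w : `|\sum_(l < n.+1) (f (X i l w) - f (X j l w))| <= n.+1%:R * (2 * (G + 1)).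
  apply: le_trans (ler_norm_sum _ _ _) _.
  apply: (@le_trans _ _ (\sum_(l < n.+1) (2 * (G + 1)))); first exact: ler_sum.
  by rewrite sumr_const card_ord [leRHS]mulr_natl.
apply: (@mean_sqr_le_mmd2 Zs (2 * (G + 1))) => //.
- by move=> n; rewrite (funext (ZsE n)); exact: measurable_funM.
- move=> n w; rewrite ZsE normrM ger0_norm ?invr_ge0 ?(ltW (n0 n))//.
  by rewrite mulrC ler_pdivrMr// [leRHS]mulrC.
- move=> n w; rewrite /Zs exprMn exprVn mul1r ler_wpM2l ?invr_ge0 ?sqr_ge0//.
  by rewrite vstat_qform; exact: (rkhs_unit_ballP k f).1.
- move=> n; under eq_Rintegral do rewrite ZsE; rewrite RintegralZl//; last first.
    by apply: (@integrable_bounded _ _ _ P _ (n.+1%:R * (2 * (G + 1)))).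
  rewrite Rintegral_sum_seq; last first.
    move=> l; apply: (@integrable_bounded _ _ _ P _ (2 * (G + 1))) => //.
    exact: measurable_funB.
  rewrite (eq_bigr (fun=> \int[p i]_x f x - \int[p j]_x f x)); last first.
    move=> l _; rewrite RintegralB//; last 2 first.
    - by apply: (@integrable_bounded _ _ _ P _ (G + 1)).
    - by apply: (@integrable_bounded _ _ _ P _ (G + 1)).
    by rewrite !(Rintegral_X _ _ mf fB).
  by rewrite sumr_const card_ord -[X in _ * X]mulr_natl mulrA mulVf ?mul1r// gt_eqF.
Qed.

(** [Zs] pairs [s] with the empirical difference, and Cauchy-Schwarz bounds its square. After
    normalisation this puts the witness function [kmean i - kmean j] in the ball. *)
Lemma lform_kmean_le s : lform (fun x => kmean i x - kmean j x) s ^+ 2 <= qform k s s * mmd2.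
Proof.
pose Zs n w := n.+1%:R^-1 * qform k s (sample n.+1 w).
have n0 n : 0 < n.+1%:R :> R by rewrite ltr0n.
pose e x l w := k x (X i l w) - k x (X j l w).
have me x l : measurable_fun setT (e x l).
  by apply: measurable_funB; apply: measurableT_comp => //; exact: measurable_ksection kmeas x.
have eB x l w : `|e x l w| <= 2 * G.
  by rewrite (le_trans (ler_normB _ _))// mulr_natl mulr2n lerD// norm_k.
have ZsE n w : Zs n w = n.+1%:R^-1 * \sum_(a <- s) a.1 * \sum_(l < n.+1) e a.2 l w.
  rewrite /Zs /qform /sample; congr (_ * _); apply: eq_bigr => a _.
  rewrite big_cat !big_map !big_mkord/= -big_split/= mulr_sumr.
  by apply: eq_bigr => l _; rewrite /e; ring.
have mS n x : measurable_fun setT (fun w => \sum_(l < n.+1) e x l w).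
  by apply: measurable_sum => l.
have SB n x w : `|\sum_(l < n.+1) e x l w| <= n.+1%:R * (2 * G).
  apply: le_trans (ler_norm_sum _ _ _) _.
  apply: (@le_trans _ _ (\sum_(l < n.+1) (2 * G))); first exact: ler_sum.
  by rewrite sumr_const card_ord [leRHS]mulr_natl.
have mA n : measurable_fun setT (fun w => \sum_(a <- s) a.1 * \sum_(l < n.+1) e a.2 l w).
  by apply: measurable_sum => a; exact: measurable_funM.
have AB n w : `|\sum_(a <- s) a.1 * \sum_(l < n.+1) e a.2 l w| <=
    n.+1%:R * \sum_(a <- s) `|a.1| * (2 * G).
  apply: le_trans (ler_norm_sum _ _ _) _; rewrite mulr_sumr; apply: ler_sum => a _.
  by rewrite normrM mulrCA ler_wpM2l.
apply: (@mean_sqr_le_mmd2 Zs (\sum_(a <- s) `|a.1| * (2 * G))) => //.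
- exact: qform_ge0.
- by move=> n; rewrite (funext (ZsE n)); exact: measurable_funM.
- move=> n w; rewrite ZsE normrM ger0_norm ?invr_ge0 ?(ltW (n0 n))//.
  by rewrite mulrC ler_pdivrMr// [leRHS]mulrC.
- move=> n w; rewrite /Zs exprMn exprVn [leRHS]mulrCA ler_wpM2l ?invr_ge0 ?sqr_ge0//.
  by rewrite vstat_qform; exact: qform_CS.
- move=> n; under eq_Rintegral do rewrite ZsE; rewrite RintegralZl//; last first.
    exact: (@integrable_bounded _ _ _ P _ _ (mA n) (AB n)).
  rewrite Rintegral_sum_seq; last first.
    move=> a; apply: (@integrable_bounded _ _ _ P _ (`|a.1| * (n.+1%:R * (2 * G)))).
      exact: measurable_funM.
    by move=> w; rewrite normrM ler_wpM2l.
  rewrite mulr_sumr; apply: eq_bigr => a _.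
  rewrite RintegralZl//; last exact: (@integrable_bounded _ _ _ P _ _ (mS n a.2) (SB n a.2)).
  rewrite Rintegral_sum_seq; last first.
    by move=> l; exact: (@integrable_bounded _ _ _ P _ _ (me a.2 l) (eB a.2 l)).
  rewrite (eq_bigr (fun=> kmean i a.2 - kmean j a.2)); last first.
    move=> l _; rewrite /e RintegralB//; last 2 first.
    - apply: (@integrable_bounded _ _ _ P _ G); last by move=> w; exact: norm_k.
      by apply: measurableT_comp => //; exact: measurable_ksection kmeas a.2.
    - apply: (@integrable_bounded _ _ _ P _ G); last by move=> w; exact: norm_k.
      by apply: measurableT_comp => //; exact: measurable_ksection kmeas a.2.
    by rewrite !(Rintegral_X _ _ (measurable_ksection kmeas a.2) (norm_k a.2)).
  rewrite sumr_const card_ord -[X in _ * (_ * X)]mulr_natl mulrCA; congr (_ * _).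
  by rewrite mulrA mulVf ?mul1r// gt_eqF.
Qed.

Lemma mmdE : mmd k (p i) (p j) = Num.sqrt mmd2.
Proof.
pose S := [set fine (\int[p i]_x (f x)%:E) - fine (\int[p j]_x (f x)%:E)
      | f in rkhs_unit_ball k].
have ubS : ubound S (Num.sqrt mmd2).
  by move=> _ [f bf <-]; exact: witness_diff_le.
have ball0 : rkhs_unit_ball k (cst 0).
  apply/(rkhs_unit_ballP k) => s; rewrite /lform big1 ?expr0n ?qform_ge0// => a _.
  by rewrite mulr0.
apply/eqP; rewrite eq_le; apply/andP; split.
  apply: ge_sup => //.
  by exists (fine (\int[p i]_x (0 : R)%:E) - fine (\int[p j]_x (0 : R)%:E)), (cst 0).
apply: ub_le_sup; first by exists (Num.sqrt mmd2).
(* The supremum is attained: by the zero function if [mmd2 = 0], else by the normalised witness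
   function. *)
have [D0|Dn0] := eqVneq mmd2 0.
  exists (cst 0) => //.
  by rewrite D0 sqrtr0 [X in X - _](Rintegral_cst1 (p i)) [X in _ - X](Rintegral_cst1 (p j)) subrr.
have Dp : 0 < mmd2 by rewrite lt_def Dn0 mmd2_ge0.
have rp : 0 < Num.sqrt mmd2 by rewrite sqrtr_gt0.
exists (fun x => (Num.sqrt mmd2)^-1 * (kmean i x - kmean j x)).
  apply/(rkhs_unit_ballP k) => s.
  have -> : lform (fun x => (Num.sqrt mmd2)^-1 * (kmean i x - kmean j x)) s =
      (Num.sqrt mmd2)^-1 * lform (fun x => kmean i x - kmean j x) s.
    by rewrite /lform mulr_sumr; apply: eq_bigr => a _; rewrite mulrCA.
  rewrite exprMn exprVn sqr_sqrtr ?mmd2_ge0// mulrC ler_pdivrMr//.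
  exact: lform_kmean_le.
have kmi a b : (p a).-integrable setT (EFin \o kmean b).
  by apply: (@integrable_bounded _ _ _ _ _ G); [exact: measurable_kmean|exact: norm_kmean].
have kmBi a : (p a).-integrable setT (EFin \o (fun x => kmean i x - kmean j x)).
  exact: (integrableB measurableT (kmi a i) (kmi a j)).
have Ia a : fine (\int[p a]_x ((Num.sqrt mmd2)^-1 * (kmean i x - kmean j x))%:E) =
    (Num.sqrt mmd2)^-1 * (kmean2 a i - kmean2 a j).
  etransitivity; first exact: (RintegralZl _ measurableT (kmBi a)).
  by congr (_ * _); exact: (RintegralB measurableT (kmi a i) (kmi a j)).
rewrite !Ia -mulrBr (_ : _ - _ = mmd2); last first.
  by rewrite /mmd2 (kmean2C j i); ring.
by rewrite -{2}(sqr_sqrtr mmd2_ge0) expr2 mulKf// gt_eqF.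
Qed.

Lemma measurable_dhat n : measurable_fun setT (dhat k X i j n).
Proof.
rewrite (funext (dhatE n)).
have mV : measurable_fun setT (fun w => (n%:R ^+ 2)^-1 * vstat n w).
  by apply: measurable_funM => //; exact: measurable_vstat.
exact: (measurableT_comp (continuous_measurable_fun (@sqrt_continuous R)) mV).
Qed.

Lemma dhat_le n w : dhat k X i j n w <= Num.sqrt (2 * G + 1).
Proof.
rewrite dhatE ler_wsqrtr//; case: n => [|n].
  by rewrite /vstat_sum big_ord0 mulr0; have := kbound_ge0; lra.
rewrite mulrC ler_pdivrMr ?exprn_gt0 ?ltr0n//.
apply: (@le_trans _ _ (\sum_(l < n.+1) \sum_(m < n.+1) (2 * G + 1))).
  apply: ler_sum => l _; apply: ler_sum => m _.
  by rewrite (le_trans (ler_norm _))// norm_hker.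
by rewrite !sumr_const card_ord expr2 mulrA !mulr_natr.
Qed.

(** A difference of square roots is at most their sum in absolute value, so its square is at most
    the difference of the arguments. Hence the V-statistic is used at tolerance [eta ^+ 2]. *)
Lemma dhat_concentration (eta : R) : i != j -> 0 < eta ->
  exists A c : R, [/\ 0 < A, 0 < c & exists n0, forall n, (n0 <= n)%N ->
    (P [set w | (eta <= `|dhat k X i j n w - mmd k (p i) (p j)|)%R] <=
     (A * expR (- c * n%:R))%:E)%E].
Proof.
move=> ij eta0.
have iZ s : uniq s -> indep P Zpair s.
  move=> us; apply: (@indep_pairing _ _ _ P _ _ _ _ (fun il => X il.1 il.2)
    (fun l => (i, l)) (fun l => (j, l)) s) => //.
  rewrite cat_uniq !map_inj_uniq ?us; [|by move=> ? ? []|by move=> ? ? []].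
  rewrite andbT/=; apply/hasPn => _ /mapP[l _ ->]; apply/negP => /mapP[m _ []].
  by move=> /esym/eqP; rewrite (negbTE ij).
have B0 : 0 < 2 * G + 1 by have := kbound_ge0; lra.
have [A [c [A0 c0 [n0 hn]]]] := vstat_concentration measurable_Zpair iZ measurable_hker
  B0 norm_hker hker_mean (exprn_gt0 2 eta0).
exists A, c; split=> //; exists (maxn n0 1) => n; rewrite geq_max => /andP[n0n n1].
apply: le_trans (hn n n0n).
have nR : 0 < n%:R :> R by rewrite ltr0n.
apply: le_measure; rewrite ?inE.
- apply: measurable_set_ge; apply: measurableT_comp => //; apply: measurable_funB => //.
  exact: measurable_dhat.
- apply: measurable_set_ge; apply: measurableT_comp => //; apply: measurable_funB => //.
  exact: measurable_vstat.
move=> w /=; rewrite dhatE mmdE => h.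
have V0 : 0 <= (n%:R ^+ 2)^-1 * vstat n w by rewrite mulr_ge0 ?vstat_ge0// invr_ge0 sqr_ge0.
have -> : vstat n w - n%:R ^+ 2 * mmd2 = n%:R ^+ 2 * ((n%:R ^+ 2)^-1 * vstat n w - mmd2).
  by field; rewrite gt_eqF.
rewrite normrM ger0_norm ?sqr_ge0// mulrC ler_wpM2l ?sqr_ge0//.
rewrite -{1}(sqr_sqrtr V0) -{1}(sqr_sqrtr mmd2_ge0) subr_sqr normrM expr2.
rewrite ler_pM ?(ltW eta0)//; apply: le_trans h _.
rewrite [leRHS]ger0_norm ?addr_ge0 ?sqrtr_ge0//.
have := sqrtr_ge0 mmd2; have := sqrtr_ge0 ((n%:R ^+ 2)^-1 * vstat n w).
by move=> ? ?; rewrite ler_norml; apply/andP; split; lra.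
Qed.

End Pair.
End MMD.

(** * The stopping time *)

Section Union.
Context {R : realType} {d : measure_display} {T : measurableType d}.
Variable P : probability T R.

Lemma probability_bigsetU_le {I : Type} (s : seq I) (F : I -> set T) :
  (forall i, measurable (F i)) ->
  (P (\big[setU/set0]_(i <- s) F i) <= \sum_(i <- s) P (F i))%E.
Proof.
move=> mF; elim: s => [|i s IH]; first by rewrite !big_nil measure0.
rewrite !big_cons; apply: le_trans (measureU2 _ _ _) _ => //.
  exact: bigsetU_measurable.
by rewrite leeD.
Qed.

(** A union bound with the smallest rate. The cap 1 on the rates and the [1 +] in the constant keep
    both positive even for empty [I]. *)
Lemma exp_tail_bigsetU {I : finType} (F : I -> nat -> set T) :
  (forall i n, measurable (F i n)) ->
  (forall i, exists A c : R, [/\ 0 < A, 0 < c & exists n0, forall n, (n0 <= n)%N ->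
     (P (F i n) <= (A * expR (- c * n%:R))%:E)%E]) ->
  exists A c : R, [/\ 0 < A, 0 < c & exists n0, forall n, (n0 <= n)%N ->
     (P (\big[setU/set0]_i F i n) <= (A * expR (- c * n%:R))%:E)%E].
Proof.
move=> mF hF.
have : forall i, exists t : R * R * nat, [/\ 0 < t.1.1, 0 < t.1.2 & forall n, (t.2 <= n)%N ->
     (P (F i n) <= (t.1.1 * expR (- t.1.2 * n%:R))%:E)%E].
  by move=> i; have [A [c [A0 c0 [n0 h]]]] := hF i; exists (A, c, n0).
move=> /choice[t ht].
pose c := \big[Num.min/1]_i (t i).1.2.
exists (1 + \sum_i (t i).1.1), c; split.
- by rewrite ltr_pwDl// sumr_ge0// => i _; have [/ltW] := ht i.
- by apply: lt_bigmin => // i _; have [] := ht i.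
exists (\max_i (t i).2) => n hn.
apply: le_trans (probability_bigsetU_le _ _) _ => //.
apply: (@le_trans _ _ (\sum_i ((t i).1.1 * expR (- c * n%:R))%:E)%E).
  apply: lee_sum => i _; have [A0 c0 h] := ht i.
  apply: le_trans (h n _) _; first exact: leq_trans (leq_bigmax i) hn.
  by rewrite lee_fin ler_pM2l// ler_expR !mulNr lerN2 ler_wpM2r// bigmin_le.
rewrite sumEFin lee_fin -mulr_suml ler_wpM2r ?expR_ge0//; lra.
Qed.

Lemma nneseries_expR (A c : R) (n1 : nat) : 0 < c ->
  (\sum_(n <oo) (A * expR (- c * (n1 + n)%:R))%:E =
   (A * expR (- c * n1%:R) / (1 - expR (- c)))%:E)%E.
Proof.
move=> c0; apply/cvg_lim => //.
rewrite (_ : (fun n => _) = EFin \o series (geometric (A * expR (- c * n1%:R)) (expR (- c)))).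
  apply: cvg_EFin; first by near=> n.
  apply: cvg_geometric_series; rewrite ger0_norm ?expR_ge0// expR_lt1; lra.
apply/funext => n /=; rewrite sumEFin seriesEnat/=; congr EFin.
apply: eq_bigr => m _; rewrite -expRM_natl -mulrA -expRD natrD; congr (_ * expR _); ring.
Unshelve. all: by end_near. Qed.

Lemma exp_tail_sum_le (F : nat -> set T) (A c : R) (n1 : nat) : 0 < c ->
  (forall n, (n1 <= n)%N -> (P (F n) <= (A * expR (- c * n%:R))%:E)%E) ->
  (\sum_(n <oo) P (F (n1 + n)%N) <= (A * expR (- c * n1%:R) / (1 - expR (- c)))%:E)%E.
Proof.
move=> c0 h; rewrite -nneseries_expR//; apply: lee_nneseries => // n _.
by apply: h; rewrite leq_addr.
Qed.

End Union.

Section Stopping.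
Context {R : realType} {dO : measure_display} {Omega : measurableType dO}.
Context {T : Type} {M : nat}.
Variables (P : probability Omega R) (k : T -> T -> R) (X : 'I_M -> nat -> Omega -> T).
Variable cl : nat -> Omega -> {set {set 'I_M}}.
Hypothesis mdhat : forall i j n, measurable_fun setT (dhat k X i j n).
Hypothesis mcl : forall n (Q : {set {set 'I_M}}), measurable (cl n @^-1` [set Q]).
Variable C : R.

Local Notation stops n w := (stop_cond k X cl C n w).
Local Notation tau := (stop_time k X cl C).

Lemma dhat_ge0 i j n w : 0 <= dhat k X i j n w.
Proof. exact: sqrtr_ge0. Qed.

Lemma stop_timeP w :
  (exists n, [/\ stops n w, (forall m, stops m w -> (n <= m)%N) & tau w = (n%:R)%:E]) \/
  ((forall n, ~ stops n w) /\ tau w = +oo%E).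
Proof.
rewrite /stop_time; case: pselect => [h|h]; [left|right].
  case: ex_minnP => n /asboolP hn mn; exists n; split=> // m hm.
  by apply: mn; apply/asboolP.
by split=> // n hn; apply: h; exists n.
Qed.

Lemma measurable_inter_min_ge (c : R) n (Q : {set {set 'I_M}}) :
  measurable [set w | c <= inter_min (fun i j => dhat k X i j n w) Q].
Proof.
pose valid (q : 'I_M * 'I_M) :=
  [exists A : {set 'I_M}, exists B : {set 'I_M},
    [&& A \in Q, B \in Q, A != B, q.1 \in A & q.2 \in B]].
have validP q : reflect (exists A B,
    [/\ A \in Q, B \in Q, A != B, q.1 \in A & q.2 \in B]) (valid q).
  apply: (iffP existsP) => [[A /existsP[B /and5P[]]]|[A [B [? ? ? ? ?]]]]; first by exists A, B.
  by exists A; apply/existsP; exists B; apply/and5P.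
(* Without two points in different parts the infimum is over the empty set, hence 0, and the event
   is everything or nothing. *)
case: (pickP valid) => [q0 q0v|nov]; last first.
  have -> : [set w | c <= inter_min (fun i j => dhat k X i j n w) Q] =
      (if c <= 0 then setT else set0).
    apply/seteqP; split=> w /=; rewrite /inter_min (_ : [set r | _] = set0) ?inf0; try by case: ifP.
    - by apply/seteqP; split=> // r [i [j [A [B [h _]]]]];
        have /validP : exists A B, [/\ A \in Q, B \in Q, A != B, (i, j).1 \in A & (i, j).2 \in B];
        [exists A, B|rewrite nov].
    - by apply/seteqP; split=> // r [i [j [A [B [h _]]]]];
        have /validP : exists A B, [/\ A \in Q, B \in Q, A != B, (i, j).1 \in A & (i, j).2 \in B];
        [exists A, B|rewrite nov].
  by case: ifP.
have -> : [set w | c <= inter_min (fun i j => dhat k X i j n w) Q] =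
    \bigcap_(q in [set q | valid q]) [set w | c <= dhat k X q.1 q.2 n w].
  apply/seteqP; split=> w /=.
    move=> h q /validP[A [B [QA QB AB iA jB]]]; apply: le_trans h _.
    by apply: (inter_min_le _ QA QB AB iA jB) => i j; exact: dhat_ge0.
  move=> h; apply: lb_le_inf.
    have /validP[A [B h0]] := q0v.
    by exists (dhat k X q0.1 q0.2 n w), q0.1, q0.2, A, B.
  move=> _ [i [j [A [B [h0 ->]]]]]; apply: (h (i, j)) => /=; apply/validP; by exists A, B.
apply: fin_bigcap_measurable => // q _; exact: measurable_set_ge.
Qed.

Lemma measurable_stop_cond n : measurable [set w | stops n w].
Proof.
have [n2|n2] := leqP 2 n; last first.
  rewrite (_ : [set w | _] = set0)//; apply/seteqP; split=> // w [].
  by rewrite leqNgt n2.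
have -> : [set w | stops n w] = \bigcup_(Q in [set: {set {set 'I_M}}])
    (cl n @^-1` [set Q] `&`
     [set w | C / Num.sqrt n%:R <= inter_min (fun i j => dhat k X i j n w) Q]).
  apply/seteqP; split=> w /=; first by move=> [_ h]; exists (cl n w).
  by move=> [Q _ [/= <-]].
apply: fin_bigcup_measurable => // Q _; apply: measurableI => //.
exact: measurable_inter_min_ge.
Qed.

Lemma measurable_stop_time_eq n : measurable [set w | tau w = (n%:R)%:E].
Proof.
have -> : [set w | tau w = (n%:R)%:E] =
    [set w | stops n w] `&` \bigcap_(m in [set m | (m < n)%N]) ~` [set w | stops m w].
  apply/seteqP; split=> w /=.
    case: (stop_timeP w) => [[m [hm mn ->]]|[_ ->]//].
    move=> [/eqP]; rewrite eqr_nat => /eqP mE; split=> [|m' /= m'n]; first by rewrite -mE.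
    by move=> /mn; rewrite mE leqNgt m'n.
  move=> [hn hm]; case: (stop_timeP w) => [[m [sm mn ->]]|[/(_ n)//]].
  congr ((_%:R)%:E); apply/eqP; rewrite eqn_leq mn//= leqNgt; apply/negP => m_n.
  exact: (hm m m_n).
apply: measurableI; first exact: measurable_stop_cond.
apply: fin_bigcap_measurable => [|m _]; first exact: finite_II.
by apply: measurableC; exact: measurable_stop_cond.
Qed.

Lemma measurable_stop_time : measurable_fun setT tau.
Proof.
move=> _ Y mY; rewrite setTI.
pose S (n : nat) := [set w | tau w = (n%:R)%:E].
have mS n : measurable (S n) by exact: measurable_stop_time_eq.
have Soo w : (forall n, ~ S n w) <-> tau w = +oo%E.
  case: (stop_timeP w) => [[m [_ _ h]]|[_ h]]; split=> //.
  - by move/(_ m).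
  - by rewrite h.
  - by move=> _ n; rewrite /S /= h.
have -> : tau @^-1` Y = (\bigcup_n (if `[< Y (n%:R)%:E >] then S n else set0)) `|`
    (if `[< Y +oo%E >] then ~` \bigcup_n S n else set0).
  apply/seteqP; split=> w /=.
    case: (stop_timeP w) => [[m [_ _ h]]|[_ h]]; rewrite h => hY; [left|right].
      by exists m => //; rewrite asboolT.
    by rewrite asboolT// => -[n _ hn]; exact: ((Soo w).2 h n hn).
  move=> [[n _]|]; case: asboolP => //.
    by move=> hY ->.
  by move=> hY hS; rewrite (Soo w).1// => n hn; apply: hS; exists n.
apply: measurableU.
  by apply: bigcupT_measurable => n; case: ifP.
by case: ifP => // _; apply: measurableC; exact: bigcupT_measurable.
Qed.

Lemma measurable_error_event Pi : measurable (error_event k X cl C Pi).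
Proof.
have -> : error_event k X cl C Pi =
    ~` \bigcup_n ([set w | tau w = (n%:R)%:E] `&` cl n @^-1` [set Pi]).
  apply/seteqP; split=> w /= h; last by move=> [n h']; apply: h; exists n.
  by move=> [n _ h']; apply: h; exists n.
apply: measurableC; apply: bigcupT_measurable => n; apply: measurableI => //.
exact: measurable_stop_time_eq.
Qed.

Lemma stop_time_ge0 w : (0 <= tau w)%E.
Proof. by case: (stop_timeP w) => [[n [_ _ ->]]|[_ ->]]//; rewrite lee_fin. Qed.

Variable bad : nat -> set Omega.
Hypothesis mbad : forall n, measurable (bad n).

(** Every time from [n2] on that precedes the stop is bad, so the stopping time exceeds [n2] by at
    most the number [S] of bad times from [n2] on. *)
Lemma expected_stop_time_le n2 :
  (forall n w, (n2 <= n)%N -> ~ bad n w -> stops n w) ->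
  (\int[P]_w tau w <= (n2%:R)%:E + \sum_(n <oo) P (bad (n2 + n)))%E.
Proof.
move=> hb; pose S w := (\sum_(n <oo) (\1_(bad (n2 + n)) w : R)%:E)%E.
have ind0 n w : (0 <= (\1_(bad (n2 + n)) w : R)%:E)%E by rewrite lee_fin.
have S0 w : (0 <= S w)%E by exact: nneseries_ge0.
have mind n : measurable_fun setT (fun w => (\1_(bad (n2 + n)) w : R)%:E).
  by apply/measurable_EFinP; exact: measurable_indic.
have mS : measurable_fun setT S.
  have := @ge0_emeasurable_sum _ _ R setT (fun n w => (\1_(bad (n2 + n)) w : R)%:E) xpredT.
  by apply.
have Sge j w : (forall n, (n < j)%N -> bad (n2 + n) w) -> ((j%:R)%:E <= S w)%E.
  move=> hj; apply: le_trans (nneseries_lim_ge (P := xpredT) j _) => //.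
  rewrite (eq_big_nat _ _ (F2 := fun=> 1%E)); last first.
    by move=> n /andP[_ nj]; rewrite indicE mem_set//; exact: hj.
  by rewrite big_mkord sumEFin sumr_const card_ord.
apply: (@le_trans _ _ (\int[P]_w ((n2%:R)%:E + S w))%E).
  apply: ge0_le_integral => //.
  - by move=> w _; exact: stop_time_ge0.
  - exact: measurable_stop_time.
  - exact: emeasurable_funD.
  move=> w _; case: (stop_timeP w) => [[m [_ mmin ->]]|[nos ->]].
    have [mn2|n2m] := leqP m n2.
      by rewrite (@le_trans _ _ (n2%:R)%:E)// ?lee_fin ?ler_nat// leeDl.
    apply: le_trans (leeD2l _ (Sge (m - n2)%N w _)); last first.
      move=> n nm; apply: contrapT => nb.
      have := hb (n2 + n)%N w (leq_addr _ _) nb => /mmin; lia.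
    by rewrite -EFinD -natrD subnKC// ltnW.
  (* A path without any stop is bad at all times from [n2] on. *)
  rewrite (_ : S w = +oo%E)//; apply: eq_infty => r.
  apply: le_trans (Sge (Num.truncn r).+1 w _).
    by rewrite lee_fin ltW// truncnS_gt.
  move=> n _; apply: contrapT => nb; exact: (nos _ (hb _ _ (leq_addr _ _) nb)).
rewrite ge0_integralD//.
rewrite integral_cst// [X in (_ * X)%E](_ : _ = 1%E); last exact: probability_setT.
rewrite mule1 leeD2l// integral_nneseries//.
apply: lee_nneseries => [n _ _|n _]; first exact: integral_ge0.
by rewrite integral_indic// setIT.
Qed.

(** If no time from [n1] on is bad, the stopping condition holds at [n1 + n2], so a first stop
    exists; it is not before [n1], and the output there is [Pi]. *)
Lemma error_event_le n1 n2 (Pi : {set {set 'I_M}}) :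
  (forall n w, (n2 <= n)%N -> ~ bad n w -> stops n w) ->
  (forall n w, ~ bad n w -> cl n w = Pi) ->
  (forall n w, stops n w -> (n1 <= n)%N) ->
  (P (error_event k X cl C Pi) <= \sum_(n <oo) P (bad (n1 + n)))%E.
Proof.
move=> h2 hcl h1; apply: measure_sigma_subadditive => //.
  exact: measurable_error_event.
move=> w err; apply: contrapT => nbad.
have good n : (n1 <= n)%N -> ~ bad n w.
  by move=> n1n hb; apply: nbad; exists (n - n1)%N => //; rewrite subnKC.
case: (stop_timeP w) => [[n [sn _ tE]]|[/(_ (n1 + n2)%N) + _]].
  by apply: err; exists n; split=> //; apply: hcl; exact: good (h1 _ _ sn).
apply; apply: h2; first exact: leq_addl.
by apply: good; exact: leq_addr.
Qed.

End Stopping.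

(** Any link between parts is squeezed between the threshold and the square root of [b]. With no
    link at all the infimum would be 0, below the positive threshold. *)
Lemma stop_cond_lower {R : realType} {Omega T : Type} {M : nat} (k : T -> T -> R)
    (X : 'I_M -> nat -> Omega -> T) cl (C b : R) n w : 0 < C -> 0 <= b ->
  (forall i j, dhat k X i j n w <= Num.sqrt b) ->
  stop_cond k X cl C n w -> C ^+ 2 <= b * n%:R.
Proof.
move=> C0 b0 db [n2]; rewrite /inter_min; set S := [set r | _] => h.
have n0 : 0 < n%:R :> R by rewrite ltr0n; lia.
have rn : 0 < Num.sqrt n%:R :> R by rewrite sqrtr_gt0.
have Cn : 0 < C / Num.sqrt n%:R by rewrite divr_gt0.
have [S0|/set0P[r Sr]] := eqVneq S set0.
  by move: (lt_le_trans Cn h); rewrite S0 inf0 ltxx.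
have rb : r <= Num.sqrt b by case: Sr => i [j [A [B [_ ->]]]].
have lbS : has_lbound S by exists 0 => _ [i [j [A [B [_ ->]]]]]; exact: sqrtr_ge0.
have : C / Num.sqrt n%:R <= Num.sqrt b.
  by apply: le_trans h (le_trans (ge_inf lbS Sr) rb).
rewrite ler_pdivrMr// -sqrtrM// => hC.
rewrite -[leRHS]sqr_sqrtr ?mulr_ge0 ?(ltW n0)//.
by rewrite lerXn2r ?nnegrE ?sqrtr_ge0 ?(ltW C0).
Qed.

Theorem theorem5 (R : realType)
  (dO : measure_display) (Omega : measurableType dO) (P : probability Omega R)
  (dT : measure_display) (T : measurableType dT)
  (M K : nat) (hM : (2 <= M)%N) (hK : (2 <= K)%N)
  (Ptrue : {set {set 'I_M}})
  (hpart : finset.partition Ptrue [set: 'I_M]%SET) (hcard : #|Ptrue| = K)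
  (p : 'I_M -> probability T R)
  (X : 'I_M -> nat -> Omega -> T)
  (hXmeas : forall i l, measurable_fun setT (X i l))
  (hXdist : forall i l (B : set T), measurable B -> P (X i l @^-1` B) = p i B)
  (hXind : mutually_independent P (fun il : 'I_M * nat => X il.1 il.2))
  (k : T -> T -> R) (G : R)
  (hkmeas : measurable_fun setT (fun z : T * T => k z.1 z.2))
  (hkpd : pos_def_kernel k)
  (hkb : forall x y, 0 <= k x y <= G)
  (hdIH : d_I (fun i j => mmd k (p i) (p j)) Ptrue
          < d_H (fun i j => mmd k (p i) (p j)) Ptrue) :
  exists alpha : R, 0 < alpha /\
    forall cl : nat -> Omega -> {set {set 'I_M}},
      (forall n w, slink_output (fun i j => dhat k X i j n w) K (cl n w)) ->
      (forall n (Q : {set {set 'I_M}}), measurable (cl n @^-1` [set Q])) ->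
      forall eps : R, 0 < eps ->
        exists C0 : R, forall C : R, C0 <= C ->
          P (error_event k X cl C Ptrue) = 0%E \/
          (\int[P]_w stop_time k X cl C w
            <= ((1 + eps) * (- ln (fine (P (error_event k X cl C Ptrue)))) / alpha)%:E)%E.
Proof.
have iX := mutually_independentP (fun il => hXmeas il.1 il.2) hXind.
set d := fun i j => mmd k (p i) (p j) in hdIH *.
have d_ge0 i j : 0 <= d i j.
  by rewrite /d (mmdE hXmeas hXdist iX hkmeas hkpd hkb) sqrtr_ge0.
have mdhat i j n : measurable_fun setT (dhat k X i j n).
  exact: (measurable_dhat hXmeas hkmeas).
have G0 : 0 <= G by exact: kbound_ge0 hkb.
pose a := 2 * G + 1.
have a0 : 0 < a by rewrite /a; lra.
have dI0 := d_I_ge0 d Ptrue.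
set dH := d_H d Ptrue in hdIH; set dI := d_I d Ptrue in hdIH dI0.
have dH0 : 0 < dH by lra.
pose eta := (dH - dI) / 4.
have eta0 : 0 < eta by rewrite /eta; lra.
have sep : dI + 3 * eta < dH by rewrite /eta; lra.
have eta_dH : dH / 2 <= dH - eta by rewrite /eta; lra.
pose F (q : 'I_M * 'I_M) n : set Omega :=
  if q.1 != q.2 then [set w | eta <= `|dhat k X q.1 q.2 n w - d q.1 q.2|] else set0.
have mF q n : measurable (F q n).
  rewrite /F; case: ifP => // _; apply: measurable_set_ge.
  by apply: measurableT_comp => //; exact: measurable_funB.
pose bad n := \big[setU/set0]_q F q n.
have mbad n : measurable (bad n) by exact: bigsetU_measurable.
have [A [c [A0 c0 [n0 tail]]]] : exists A c : R, [/\ 0 < A, 0 < c &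
    exists n0, forall n, (n0 <= n)%N -> (P (bad n) <= (A * expR (- c * n%:R))%:E)%E].
  apply: exp_tail_bigsetU => // -[i j]; rewrite /F /=.
  have [ij|ij] := eqVneq i j; last first.
    exact: (dhat_concentration hXmeas hXdist iX hkmeas hkpd hkb ij eta0).
  by exists 1, 1; split=> //; exists 0%N => n _; rewrite measure0 lee_fin mul1r expR_ge0.
have good n w : ~ bad n w ->
    forall i j, i != j -> `|dhat k X i j n w - d i j| < eta.
  move=> nb i j ij; rewrite ltNge; apply/negP => h; apply: nb.
  by rewrite /bad (bigD1 (i, j))//; left; rewrite /F /= ij.
have q1 : 0 < 1 - expR (- c) by rewrite subr_gt0 expR_lt1 oppr_lt0.
pose L := A / (1 - expR (- c)).
have L0 : 0 < L by rewrite divr_gt0.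
pose kap := 4 / dH ^+ 2 + 1.
have kap0 : 0 < kap by rewrite addr_gt0// divr_gt0// exprn_gt0.
pose gam := c / (2 * a).
have gam0 : 0 < gam by rewrite divr_gt0// mulr_gt0.
exists (gam / kap); split; first by rewrite divr_gt0.
move=> cl hcl mcl eps eps0.
have goodcl n w : ~ bad n w -> cl n w = Ptrue.
  move=> nb; apply: (@slink_output_correct _ _ d (fun i j => dhat k X i j n w) _ eta) => //.
  - by move=> i j; exact: dhat_ge0.
  - exact: good.
  - by rewrite hcard.
pose lnL := ln (L * expR c).
(* Each summand meets one demand: [1] gives [C <= C ^+ 2], [a * n0] gives [n0 <= n1], the third
   handles [lnL] in the error bound, the last the bounded terms of the expected time. *)
exists (1 + a * n0%:R + 2 * a * `|lnL| / c + (n0%:R + 3 + L)) => C hC.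
have t1 : 0 <= a * n0%:R by rewrite mulr_ge0// ltW.
have t2 : 0 <= 2 * a * `|lnL| / c.
  by rewrite divr_ge0 ?(ltW c0)// mulr_ge0// mulr_ge0// ltW.
have t3 : 0 <= n0%:R :> R by [].
have C1 : 1 <= C by lra.
have C0 : 0 < C by lra.
have CC : C <= C ^+ 2 by rewrite expr2 ler_peMr// ltW.
(* No stop occurs before [n1], as [dhat ^+ 2 <= a]. Truncation loses less than one unit, which costs
   the factor [expR c] in [Pe_le]. *)
pose n1 := Num.truncn (C ^+ 2 / a).
have Ca0 : 0 <= C ^+ 2 / a by rewrite divr_ge0 ?sqr_ge0// ltW.
have /andP[n1le n1gt] := truncn_itv Ca0.
have n01 : (n0 <= n1)%N.
  by rewrite /n1 truncn_ge_nat// ler_pdivlMr// mulrC; lra.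
(* [n0] puts the exponential tail in force; the 3 rounds the truncation up and respects the start at
   time 2. *)
pose n2 := (Num.truncn (4 * C ^+ 2 / dH ^+ 2) + n0 + 3)%N.
have n2_3 : (3 <= n2)%N by rewrite /n2 leq_addl.
have n2_n0 : (n0 <= n2)%N by rewrite /n2 addnAC leq_addl.
have n2_tr : ((Num.truncn (4 * C ^+ 2 / dH ^+ 2)).+1 <= n2)%N.
  by rewrite /n2 addnS ltnS -addnA leq_addr.
have dH20 : 0 < dH ^+ 2 by rewrite exprn_gt0.
have Cd0 : 0 <= 4 * C ^+ 2 / dH ^+ 2.
  by rewrite divr_ge0 ?(ltW dH20)// mulr_ge0// sqr_ge0.
have /andP[n2le n2gt] := truncn_itv Cd0.
have stops n w : (n2 <= n)%N -> ~ bad n w -> stop_cond k X cl C n w.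
  move=> n2n nb; split; first exact: leq_trans (ltnW n2_3) n2n.
  rewrite (goodcl n w nb).
  apply: le_trans (inter_min_close hpart d_ge0 (good n w nb) _); last by rewrite hcard.
  apply: le_trans eta_dH.
  have nR : 4 * C ^+ 2 / dH ^+ 2 <= n%:R.
    by apply: le_trans (ltW n2gt) _; rewrite ler_nat; exact: leq_trans n2_tr n2n.
  have n_gt0 : 0 < n%:R :> R by rewrite ltr0n (leq_trans _ n2n)// (leq_trans _ n2_3).
  rewrite ler_pdivrMr ?sqrtr_gt0// -(@ler_pXn2r _ 2%N) ?nnegrE ?(ltW C0)//; last first.
    by rewrite mulr_ge0 ?sqrtr_ge0// divr_ge0// ltW.
  rewrite exprMn sqr_sqrtr ?(ltW n_gt0)//.
  move: nR; rewrite ler_pdivrMr// expr_div_n => nR; lra.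
have stops_lower n w : stop_cond k X cl C n w -> (n1 <= n)%N.
  move=> st; rewrite -(ler_nat R); apply: le_trans n1le _.
  rewrite ler_pdivrMr// mulrC; apply: stop_cond_lower st => //; first exact: ltW.
  by move=> i j; exact: (dhat_le X hkb).
have Pe_le : (P (error_event k X cl C Ptrue) <=
    (L * expR c * expR (- (c * (C ^+ 2 / a))))%:E)%E.
  apply: le_trans (error_event_le P mdhat mcl mbad stops goodcl stops_lower) _.
  apply: le_trans (exp_tail_sum_le c0 (fun n nn1 => tail n (leq_trans n01 nn1))) _.
  rewrite lee_fin [leLHS](_ : _ = L * expR (- c * n1%:R)); last by rewrite /L; ring.
  rewrite -mulrA ler_pM2l// -expRD ler_expR.
  move: n1gt; rewrite -natr1 -/n1 => n1gt; nra.
have EN_le : (\int[P]_w stop_time k X cl C w <= (kap * C ^+ 2)%:E)%E.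
  apply: le_trans (expected_stop_time_le P mdhat mcl mbad stops) _.
  have n02 n : (n2 <= n)%N -> (n0 <= n)%N by exact: leq_trans.
  apply: (@le_trans _ _ ((n2%:R)%:E + L%:E)%E).
    rewrite leeD2l//.
    apply: le_trans (exp_tail_sum_le c0 (fun n nn2 => tail n (n02 n nn2))) _.
    rewrite lee_fin /L ler_pM2r ?invr_gt0// ler_piMr ?(ltW A0)//.
    by rewrite -expR0 ler_expR mulNr oppr_le0 mulr_ge0// ltW.
  rewrite -EFinD lee_fin /kap mulrDl mul1r.
  have -> : 4 / dH ^+ 2 * C ^+ 2 = 4 * C ^+ 2 / dH ^+ 2 by ring.
  move: n2le; rewrite /n2 !natrD => n2le; lra.
(* For zero error probability the bound in the informal statement is infinite; from here on [pe] is
   positive and has a genuine logarithm. *)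
have [Pe0|Pen0] := eqVneq (P (error_event k X cl C Ptrue)) 0%E; [by left|right].
apply: le_trans EN_le _; rewrite lee_fin.
have merr : measurable (error_event k X cl C Ptrue) by exact: measurable_error_event.
have Pefin : P (error_event k X cl C Ptrue) \is a fin_num by exact: fin_num_measure.
set pe := fine (P (error_event k X cl C Ptrue)).
have pe0 : 0 < pe by rewrite /pe fine_gt0// lt0e Pen0 measure_ge0/= ltey_eq Pefin.
have pe_le : pe <= L * expR c * expR (- (c * (C ^+ 2 / a))).
  by rewrite -lee_fin /pe fineK.
have LE0 : 0 < L * expR c by rewrite mulr_gt0// expR_gt0.
have ln_pe : ln pe <= lnL - c * (C ^+ 2 / a).
  apply: (@le_trans _ _ (ln (L * expR c * expR (- (c * (C ^+ 2 / a)))))).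
    by rewrite ler_ln ?posrE// mulr_gt0// expR_gt0.
  by rewrite lnM ?posrE ?expR_gt0// expRK.
have key : gam * C ^+ 2 <= - ln pe.
  have lnL_le : lnL <= gam * C ^+ 2.
    apply: le_trans (ler_norm _) _.
    have : 2 * a * `|lnL| / c <= C ^+ 2 by lra.
    by rewrite /gam ler_pdivrMr// [c / _ * _]mulrAC ler_pdivlMr ?mulr_gt0//; lra.
  have e : c * (C ^+ 2 / a) = 2 * (gam * C ^+ 2).
    by rewrite /gam; field; rewrite gt_eqF.
  lra.
have -> : kap * C ^+ 2 = gam * C ^+ 2 / (gam / kap).
  by field; rewrite !gt_eqF.
rewrite ler_pM2r ?invr_gt0 ?(divr_gt0 gam0 kap0)//.
apply: (le_trans key); rewrite ler_peMl//; last lra.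
have : 0 <= gam * C ^+ 2 by rewrite mulr_ge0 ?sqr_ge0// ltW.
lra.
Qed.
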